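(* Let \[ \lambda_3=\frac12\left(2+\sqrt5-\sqrt{7+2\sqrt5}\right)\cong 0.4245 . \] Let $\xi\in\mathbb{R}$ with $[\mathbb{Q}(\xi):\mathbb{Q}]>3$, and let $c$ and $\lambda$ be positive real numbers. Suppose that for any sufficiently large value of $X$, the inequalities \[ |x_0|\le X,\quad |x_0\xi-x_1|\le cX^{-\lambda},\quad |x_0\xi^2-x_2|\le cX^{-\lambda},\quad |x_0\xi^3-x_3|\le cX^{-\lambda} \] admit a non-zero solution $\mathbf{x}=(x_0,x_1,x_2,x_3)\in\mathbb{Z}^4$. Then $\lambda\le\lambda_3$. Moreover, if $\lambda=\lambda_3$, then $c$ is bounded below by a positive constant depending only on $\xi$.
   Context: The condition $[\mathbb{Q}(\xi):\mathbb{Q}]>3$ means that $\xi$ is not algebraic over $\mathbb{Q}$ of degree at most $3$; in particular $\xi$ may be transcendental (infinite degree). *)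

(* Defs.v *)
From mathcomp Require Import all_boot all_order all_algebra.
From mathcomp Require Import all_classical all_reals all_analysis.
Set Implicit Arguments.
Unset Strict Implicit.
Unset Printing Implicit Defensive.
Import Order.TTheory GRing.Theory Num.Theory.
Import numFieldNormedType.Exports.
Local Open Scope classical_set_scope.
Local Open Scope ring_scope.

Definition lambda3 (R : realType) : R :=
  (2 + Num.sqrt 5 - Num.sqrt (7 + 2 * Num.sqrt 5)) / 2.

(* [p] is the minimal polynomial of [xi] over the rationals; recall that
   [size p] is the degree of [p] plus one. *)
Definition algebraic_of_degree (R : realType) (xi : R) (d : nat) : Prop :=
  exists p : {poly rat},
    [/\ p \is monic, irreducible_poly p, root (map_poly ratr p) xi
      & size p = d.+1].

(* [Q(xi) : Q] > n, where the degree is infinite for a transcendental [xi]. *)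
Definition extension_degree_gt (R : realType) (xi : R) (n : nat) : Prop :=
  ~ exists2 d : nat, (d <= n)%N & algebraic_of_degree xi d.

(* The coordinates of [x] are indexed by ['I_4] = {0, 1, 2, 3}. *)
Definition is_solution (R : realType) (xi c lambda X : R) (x : 'rV[int]_4) :
    Prop :=
  [/\ `|(x 0 0)%:~R| <= X,
      `|(x 0 0)%:~R * xi - (x 0 1)%:~R| <= c * X `^ (- lambda),
      `|(x 0 0)%:~R * xi ^+ 2 - (x 0 2)%:~R| <= c * X `^ (- lambda)
    & `|(x 0 0)%:~R * xi ^+ 3 - (x 0 3)%:~R| <= c * X `^ (- lambda)].

Definition uniformly_approximable (R : realType) (xi c lambda : R) : Prop :=
  \forall X \near +oo,
    exists2 x : 'rV[int]_4, x != 0 & is_solution xi c lambda X x.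

(* Main.v *)
Require Import Defs.
From mathcomp Require Import all_boot all_order all_algebra.
From mathcomp Require Import all_classical all_reals all_analysis.
From mathcomp Require Import ring lra.
Set Implicit Arguments.
Unset Strict Implicit.
Unset Printing Implicit Defensive.
Import Order.TTheory GRing.Theory Num.Theory.
Import numFieldNormedType.Exports.
Local Open Scope classical_set_scope.
Local Open Scope ring_scope.

(** Put [t = (1 - lambda3) / lambda3] ([ratio3]).  A uniform exponent larger than
    [lambda3] yields solutions at the exponent [lambda3] with [c] as small as
    desired, so everything reduces to a lower bound for [c] at the exponent
    [lambda3] itself ([uniformly_approximable_weaken],
    [no_uniform_approximation]).

    Measure an integral point [x] by its height |x_0| and its error, the largest
    of |x_k - xi x_(k-1)|.  Successive minimal points have increasing heights and
    decreasing errors; two consecutive ones form a basis of the integral points of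
    the plane they span ([lattice_basis]); and since 1, xi, xi^2, xi^3 are linearly
    independent over Q, three consecutive ones are independent infinitely often
    ([ms_noncoplanar]).  Listing these independent triples as (p_n, y_n, z_n)
    gives a [chain]: (y_n, z_n) and (p_(n+1), y_(n+1)) span the same plane, and
    comparing areas bounds height(y_(n+1)) err(p_(n+1)) by a multiple of
    height(z_n) err(y_n).

    Lower bounds come from two kinds of integers that do not vanish.

    - Let x- and x+ be the first three and the last three coordinates of [x], and
      C(x, y) = (det (x-, x+, y-), det (x-, x+, y+)).  If C(y_(n+1), p_(n+1)) were
      zero, the plane of (y_n, z_n) would be the space of solutions of a linear
      recurrence of order two.  The area of such a plane is at least the square of
      the coefficients of the recurrence, so these would be so small that the
      recurrence would hold at p_n as well ([special_bound], [ch_nonspecial]).  Hence 1 << height(z_n) err(y_n) err(y_(n+1)).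

    - Suppose that y_k lies in the space spanned by the triple of index n but z_k
      does not.  A linear form that vanishes at y_k is small at (1, xi, xi^2, xi^3),
      which sharpens the usual bound for the determinant of four points:
      height(y_k) << height(z_n) err(y_n) err(p_n) height(z_k) err(y_k)
      ([det4_jump]).

    In terms of logarithms these are linear inequalities ([exponent_system]).  The
    chain jumps at n if z_(n+1) lies outside the space of the n-th triple; this
    happens infinitely often.  If a jump at n+1 follows an index n without a jump,
    the inequalities combine to an estimate in which the main terms cancel exactly,
    because (t^2 - 1)^2 = t + t^2 - t^3; what remains is a lower bound for log c
    ([critical_exponents]).  Otherwise the chain jumps at every large index.  Then
    the inequalities have room to spare and show that the determinants of
    consecutive vectors C(y_n, z_n) in Z^2 tend to zero.  These vectors are thus
    eventually proportional, and since C(y_n, z_n) is close to a multiple of (1, xi),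
    the number xi would be rational ([exponent_system_steady], [cs_indep]). *)

(** * Integer relations between the powers of [xi] *)

(** A nonzero rational polynomial of least degree vanishing at [xi] is irreducible;
    the induction descends from a reducible polynomial to a proper factor. *)
Lemma algebraic_degree_le (R : realType) (xi : R) (p : {poly rat}) (n : nat) :
  p != 0 -> root (map_poly ratr p) xi -> (size p <= n.+1)%N ->
  exists2 d : nat, (d <= n)%N & algebraic_of_degree xi d.
Proof.
elim: n p => [|n IH] p p0 rp sp.
  have [c c0 pE] : exists2 c, c != 0 & p = c%:P.
    by move: (size1_polyC sp) => pE; exists p`_0 => //; apply: contraNneq p0 => c0;
      rewrite pE c0.
  by move: rp; rewrite pE map_polyC /= rootE hornerC fmorph_eq0 (negbTE c0).
have sp1 : (1 < size p)%N.
  rewrite ltnNge; apply/negP => h; have pE := size1_polyC h.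
  move: rp; rewrite pE map_polyC /= rootE hornerC fmorph_eq0 => c0.
  by move: p0; rewrite pE polyC_eq0 c0.
have [/existsNP[q hq]|irr] := pselect (~ forall q : {poly rat}, size q != 1%N -> q %| p -> q %= p).
  have {hq}[q1 [qp nqp]] : size q != 1%N /\ (q %| p /\ ~ q %= p).
    by move/not_implyP: hq => [? /not_implyP[]].
  have q0 : q != 0 by apply: contraNneq p0 => q0; move: qp; rewrite q0 dvd0p.
  have pE : p = p %/ q * q by rewrite divpK.
  have pq0 : p %/ q != 0 by apply: contraNneq p0 => h; rewrite pE h mul0r.
  have szq : (size q < size p)%N.
    rewrite ltn_neqAle dvdp_leq // andbT (dvdp_size_eqp qp).
    exact/negP.
  have q2 : (1 < size q)%N by rewrite ltn_neqAle eq_sym q1 size_poly_gt0.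
  have szpq : (size (p %/ q)%R < size p)%N.
    by rewrite size_divp // ltn_subrL size_poly_gt0 p0 andbT -subn1 subn_gt0.
  move: rp; rewrite pE rmorphM /= rootM => /orP[] r.
    have [d dn hd] := IH _ pq0 r (leq_trans szpq sp); by exists d => //; exact: leqW.
  have [d dn hd] := IH _ q0 r (leq_trans szq sp); by exists d => //; exact: leqW.
have {}irr : forall q : {poly rat}, size q != 1%N -> q %| p -> q %= p by apply: contrapT.
have lc0 : lead_coef p != 0 by rewrite lead_coef_eq0.
exists (size p).-1; first by rewrite -ltnS prednK // size_poly_gt0.
exists ((lead_coef p)^-1 *: p); split.
- by rewrite monicE lead_coefZ mulVf.
- split; first by rewrite size_scale ?invr_eq0.
  move=> q q1; rewrite dvdpZr ?invr_eq0 // => qp.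
  by rewrite (eqp_trans (irr _ q1 qp)) // eqp_sym eqp_scale // invr_eq0.
- by rewrite map_polyZ rootZ // fmorph_eq0 invr_eq0.
- by rewrite size_scale ?invr_eq0 // prednK // size_poly_gt0.
Qed.

Lemma no_integer_relation (R : realType) (xi : R) (a0 a1 a2 a3 : R) :
  extension_degree_gt xi 3 ->
  a0 \is a Num.int -> a1 \is a Num.int -> a2 \is a Num.int ->
  a3 \is a Num.int -> a0 + a1 * xi + a2 * xi ^+ 2 + a3 * xi ^+ 3 = 0 ->
  [/\ a0 = 0, a1 = 0, a2 = 0 & a3 = 0].
Proof.
move=> hxi /intrP[m0 ->] /intrP[m1 ->] /intrP[m2 ->] /intrP[m3 ->] h.
pose s : seq rat := [:: m0%:~R; m1%:~R; m2%:~R; m3%:~R].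
have [p0|p0] := eqVneq (Poly s) 0.
  have c k : s`_k = 0 by rewrite -coef_Poly p0 coef0.
  have z m : m%:~R = 0 :> rat -> m%:~R = 0 :> R.
    by move/eqP; rewrite intr_eq0 => /eqP ->.
  by split; apply: z; [exact: (c 0%N)|exact: (c 1%N)|exact: (c 2%N)|exact: (c 3%N)].
case: hxi; apply: (algebraic_degree_le p0); last exact: size_Poly.
rewrite rootE -[X in _ == X]h /s /= !cons_poly_def mul0r add0r.
rewrite !(rmorphD, rmorphM) /= !map_polyX !map_polyC /= !ratr_int.
by rewrite !(hornerD, hornerM, hornerX, hornerC); apply/eqP; ring.
Qed.

(** * Points, errors and normal vectors *)

Section Points.
Variable R : realType.
Implicit Types (x y z w p u v : 'rV[R]_4) (xi : R).

Definition integral_point x := forall k, x 0 k \is a Num.int.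

Definition delta1 xi x : R := x 0 1 - xi * x 0 0.
Definition delta2 xi x : R := x 0 2 - xi * x 0 1.
Definition delta3 xi x : R := x 0 3 - xi * x 0 2.
(** Using the forms x_k - xi x_(k-1) instead of x_0 xi^k - x_k changes the error by
    a bounded factor only, and agrees with the column operations that leave heights
    in a single column of the determinants below. *)
Definition err xi x : R :=
  Num.max `|delta1 xi x| (Num.max `|delta2 xi x| `|delta3 xi x|).
Definition height x : R := `|x 0 0|.

Definition det3 (a0 a1 a2 b0 b1 b2 c0 c1 c2 : R) : R :=
  a0 * (b1 * c2 - b2 * c1) - a1 * (b0 * c2 - b2 * c0)
  + a2 * (b0 * c1 - b1 * c0).

(** The four coordinates of the vector normal to the space spanned by three points,
    signed so that [det4] is the determinant of four points. *)
Definition normal0 x y z : R := - det3 (x 0 1) (x 0 2) (x 0 3)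
  (y 0 1) (y 0 2) (y 0 3) (z 0 1) (z 0 2) (z 0 3).
Definition normal1 x y z : R := det3 (x 0 0) (x 0 2) (x 0 3)
  (y 0 0) (y 0 2) (y 0 3) (z 0 0) (z 0 2) (z 0 3).
Definition normal2 x y z : R := - det3 (x 0 0) (x 0 1) (x 0 3)
  (y 0 0) (y 0 1) (y 0 3) (z 0 0) (z 0 1) (z 0 3).
Definition normal3 x y z : R := det3 (x 0 0) (x 0 1) (x 0 2)
  (y 0 0) (y 0 1) (y 0 2) (z 0 0) (z 0 1) (z 0 2).

Definition coplanar x y z : bool :=
  [&& normal0 x y z == 0, normal1 x y z == 0,
      normal2 x y z == 0 & normal3 x y z == 0].

Definition dot4 (a0 a1 a2 a3 : R) w : R :=
  a0 * w 0 0 + a1 * w 0 1 + a2 * w 0 2 + a3 * w 0 3.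

Definition det4 x y z w : R := dot4 (normal0 x y z) (normal1 x y z)
  (normal2 x y z) (normal3 x y z) w.

Lemma ord4P (P : 'I_4 -> Prop) : P 0 -> P 1 -> P 2 -> P 3 -> forall k, P k.
Proof.
move=> h0 h1 h2 h3 [[|[|[|[|k]]]] hk] //.
- by rewrite (_ : Ordinal hk = 0) //; apply: val_inj.
- by rewrite (_ : Ordinal hk = 1) //; apply: val_inj.
- by rewrite (_ : Ordinal hk = 2) //; apply: val_inj.
- by rewrite (_ : Ordinal hk = 3) //; apply: val_inj.
Qed.

Lemma point_eqP x y : x 0 0 = y 0 0 -> x 0 1 = y 0 1 -> x 0 2 = y 0 2 ->
  x 0 3 = y 0 3 -> x = y.
Proof. by move=> *; apply/rowP; apply: ord4P. Qed.

Lemma integral_pointD x y : integral_point x -> integral_point y ->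
  integral_point (x + y).
Proof. by move=> hx hy k; rewrite mxE rpredD. Qed.

Lemma integral_pointB x y : integral_point x -> integral_point y ->
  integral_point (x - y).
Proof. by move=> hx hy k; rewrite !mxE rpredB. Qed.

Lemma integral_pointZ a x : a \is a Num.int -> integral_point x ->
  integral_point (a *: x).
Proof. by move=> ha hx k; rewrite mxE rpredM. Qed.

Lemma err_ge0 xi x : 0 <= err xi x.
Proof. by rewrite /err le_max normr_ge0. Qed.

Lemma delta1_le xi x : `|delta1 xi x| <= err xi x.
Proof. by rewrite /err le_max lexx. Qed.
Lemma delta2_le xi x : `|delta2 xi x| <= err xi x.
Proof. by rewrite /err !le_max lexx orbT. Qed.
Lemma delta3_le xi x : `|delta3 xi x| <= err xi x.
Proof. by rewrite /err !le_max lexx !orbT. Qed.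

Lemma err_leP xi x e : `|delta1 xi x| <= e -> `|delta2 xi x| <= e ->
  `|delta3 xi x| <= e -> err xi x <= e.
Proof. by move=> h1 h2 h3; rewrite /err !ge_max h1 h2 h3. Qed.

Lemma err_attained xi x : [\/ err xi x = `|delta1 xi x|,
  err xi x = `|delta2 xi x| | err xi x = `|delta3 xi x|].
Proof.
rewrite /err; case: (leP `|delta2 xi x| `|delta3 xi x|) => _;
  case: leP => _; by [constructor 1|constructor 2|constructor 3].
Qed.

Lemma errN xi x : err xi (- x) = err xi x.
Proof.
by rewrite /err /delta1 /delta2 /delta3 !mxE !mulrN -!opprD !normrN.
Qed.

Lemma errD xi x y : err xi (x + y) <= err xi x + err xi y.
Proof.
have h a b : forall e f, `|a| <= e -> `|b| <= f -> `|a + b| <= e + f :> R.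
  by move=> e f ha hb; apply: le_trans (ler_normD _ _) (lerD ha hb).
apply: err_leP.
- rewrite (_ : delta1 xi (x + y) = delta1 xi x + delta1 xi y).
    exact: h (delta1_le _ _) (delta1_le _ _).
  by rewrite /delta1 !mxE; ring.
- rewrite (_ : delta2 xi (x + y) = delta2 xi x + delta2 xi y).
    exact: h (delta2_le _ _) (delta2_le _ _).
  by rewrite /delta2 !mxE; ring.
- rewrite (_ : delta3 xi (x + y) = delta3 xi x + delta3 xi y).
    exact: h (delta3_le _ _) (delta3_le _ _).
  by rewrite /delta3 !mxE; ring.
Qed.

Lemma errZ xi a x : err xi (a *: x) = `|a| * err xi x.
Proof.
rewrite /err /delta1 /delta2 /delta3 !mxE.
rewrite !(mulrCA xi) -!mulrBr !normrM.
by rewrite !maxr_pMr // le_max normr_ge0.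
Qed.

Lemma errB xi x y : err xi (x - y) <= err xi x + err xi y.
Proof. by rewrite -(errN _ y); exact: errD. Qed.

Lemma heightD x y : height (x + y) <= height x + height y.
Proof. by rewrite /height mxE ler_normD. Qed.

Lemma heightZ a x : height (a *: x) = `|a| * height x.
Proof. by rewrite /height mxE normrM. Qed.

Lemma int_small_eq0 (a : R) : a \is a Num.int -> `|a| < 1 -> a = 0.
Proof.
move=> ha h; apply/eqP; apply: contraTT h => a0.
by rewrite -leNgt norm_intr_ge1.
Qed.

Lemma integral_point0 xi x : integral_point x -> err xi x < 1 -> x 0 0 = 0 -> x = 0.
Proof.
move=> hx hL h0.
have h1 : x 0 1 = 0.
  apply: int_small_eq0 => //; apply: le_lt_trans hL.
  by have := delta1_le xi x; rewrite /delta1 h0 mulr0 subr0.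
have h2 : x 0 2 = 0.
  apply: int_small_eq0 => //; apply: le_lt_trans hL.
  by have := delta2_le xi x; rewrite /delta2 h1 mulr0 subr0.
have h3 : x 0 3 = 0.
  apply: int_small_eq0 => //; apply: le_lt_trans hL.
  by have := delta3_le xi x; rewrite /delta3 h2 mulr0 subr0.
by apply: point_eqP; rewrite mxE.
Qed.

Lemma det4_1 x y z : det4 x y z x = 0.
Proof. by rewrite /det4 /dot4 /normal0 /normal1 /normal2 /normal3 /det3; ring. Qed.
Lemma det4_2 x y z : det4 x y z y = 0.
Proof. by rewrite /det4 /dot4 /normal0 /normal1 /normal2 /normal3 /det3; ring. Qed.
Lemma det4_3 x y z : det4 x y z z = 0.
Proof. by rewrite /det4 /dot4 /normal0 /normal1 /normal2 /normal3 /det3; ring. Qed.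

(** Every vector orthogonal to three points is proportional to their normal vector;
    each minor of the two vectors is a 3 by 3 determinant with a zero column. *)
Lemma normal_proportional (a0 a1 a2 a3 : R) x y z :
  dot4 a0 a1 a2 a3 x = 0 -> dot4 a0 a1 a2 a3 y = 0 ->
  dot4 a0 a1 a2 a3 z = 0 ->
  let n0 := normal0 x y z in let n1 := normal1 x y z in
  let n2 := normal2 x y z in let n3 := normal3 x y z in
  [/\ a0 * n1 - a1 * n0 = 0, a0 * n2 - a2 * n0 = 0 & a0 * n3 - a3 * n0 = 0] /\
  [/\ a1 * n2 - a2 * n1 = 0, a1 * n3 - a3 * n1 = 0 & a2 * n3 - a3 * n2 = 0].
Proof.
move=> hx hy hz n0 n1 n2 n3.
have e01 : a0 * n1 - a1 * n0 = 0.
  transitivity (det3 (dot4 a0 a1 a2 a3 x) (x 0 2) (x 0 3) (dot4 a0 a1 a2 a3 y)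
    (y 0 2) (y 0 3) (dot4 a0 a1 a2 a3 z) (z 0 2) (z 0 3)).
    by rewrite /n0 /n1 /normal0 /normal1 /det3 /dot4; ring.
  by rewrite hx hy hz /det3; ring.
have e02 : a0 * n2 - a2 * n0 = 0.
  transitivity (- det3 (dot4 a0 a1 a2 a3 x) (x 0 1) (x 0 3) (dot4 a0 a1 a2 a3 y)
    (y 0 1) (y 0 3) (dot4 a0 a1 a2 a3 z) (z 0 1) (z 0 3)).
    by rewrite /n0 /n2 /normal0 /normal2 /det3 /dot4; ring.
  by rewrite hx hy hz /det3; ring.
have e03 : a0 * n3 - a3 * n0 = 0.
  transitivity (det3 (dot4 a0 a1 a2 a3 x) (x 0 1) (x 0 2) (dot4 a0 a1 a2 a3 y)
    (y 0 1) (y 0 2) (dot4 a0 a1 a2 a3 z) (z 0 1) (z 0 2)).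
    by rewrite /n0 /n3 /normal0 /normal3 /det3 /dot4; ring.
  by rewrite hx hy hz /det3; ring.
have e12 : a1 * n2 - a2 * n1 = 0.
  transitivity (det3 (dot4 a0 a1 a2 a3 x) (x 0 0) (x 0 3) (dot4 a0 a1 a2 a3 y)
    (y 0 0) (y 0 3) (dot4 a0 a1 a2 a3 z) (z 0 0) (z 0 3)).
    by rewrite /n1 /n2 /normal1 /normal2 /det3 /dot4; ring.
  by rewrite hx hy hz /det3; ring.
have e13 : a1 * n3 - a3 * n1 = 0.
  transitivity (- det3 (dot4 a0 a1 a2 a3 x) (x 0 0) (x 0 2) (dot4 a0 a1 a2 a3 y)
    (y 0 0) (y 0 2) (dot4 a0 a1 a2 a3 z) (z 0 0) (z 0 2)).
    by rewrite /n1 /n3 /normal1 /normal3 /det3 /dot4; ring.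
  by rewrite hx hy hz /det3; ring.
have e23 : a2 * n3 - a3 * n2 = 0.
  transitivity (det3 (dot4 a0 a1 a2 a3 x) (x 0 0) (x 0 1) (dot4 a0 a1 a2 a3 y)
    (y 0 0) (y 0 1) (dot4 a0 a1 a2 a3 z) (z 0 0) (z 0 1)).
    by rewrite /n2 /n3 /normal2 /normal3 /det3 /dot4; ring.
  by rewrite hx hy hz /det3; ring.
by split; split.
Qed.

Lemma orthogonal_normal (a0 a1 a2 a3 : R) x y z w :
  ~ (a0 = 0 /\ a1 = 0 /\ a2 = 0 /\ a3 = 0) ->
  dot4 a0 a1 a2 a3 x = 0 -> dot4 a0 a1 a2 a3 y = 0 ->
  dot4 a0 a1 a2 a3 z = 0 -> dot4 a0 a1 a2 a3 w = 0 -> det4 x y z w = 0.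
Proof.
move=> a_neq0 hx hy hz hw.
have [] := normal_proportional hx hy hz.
set n0 := normal0 x y z; set n1 := normal1 x y z.
set n2 := normal2 x y z; set n3 := normal3 x y z => -[e01 e02 e03] [e12 e13 e23].
have nxyz : det4 x y z w = n0 * w 0 0 + n1 * w 0 1 + n2 * w 0 2 + n3 * w 0 3 by [].
have e0 : a0 * det4 x y z w = 0.
  transitivity (n0 * dot4 a0 a1 a2 a3 w + (a0 * n1 - a1 * n0) * w 0 1 +
    (a0 * n2 - a2 * n0) * w 0 2 + (a0 * n3 - a3 * n0) * w 0 3).
    by rewrite nxyz /dot4; ring.
  by rewrite hw e01 e02 e03; ring.
have e1 : a1 * det4 x y z w = 0.
  transitivity (n1 * dot4 a0 a1 a2 a3 w - (a0 * n1 - a1 * n0) * w 0 0 +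
    (a1 * n2 - a2 * n1) * w 0 2 + (a1 * n3 - a3 * n1) * w 0 3).
    by rewrite nxyz /dot4; ring.
  by rewrite hw e01 e12 e13; ring.
have e2 : a2 * det4 x y z w = 0.
  transitivity (n2 * dot4 a0 a1 a2 a3 w - (a0 * n2 - a2 * n0) * w 0 0 -
    (a1 * n2 - a2 * n1) * w 0 1 + (a2 * n3 - a3 * n2) * w 0 3).
    by rewrite nxyz /dot4; ring.
  by rewrite hw e02 e12 e23; ring.
have e3 : a3 * det4 x y z w = 0.
  transitivity (n3 * dot4 a0 a1 a2 a3 w - (a0 * n3 - a3 * n0) * w 0 0 -
    (a1 * n3 - a3 * n1) * w 0 1 - (a2 * n3 - a3 * n2) * w 0 2).
    by rewrite nxyz /dot4; ring.
  by rewrite hw e03 e13 e23; ring.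
apply: contrapT => /eqP d0; apply: a_neq0.
by do !split; apply/eqP; move/eqP: e0; move/eqP: e1; move/eqP: e2; move/eqP: e3;
  rewrite !mulf_eq0 (negbTE d0) !orbF.
Qed.
End Points.

(** * Estimates for determinants *)

Section Estimates.
Variable R : realType.
Implicit Types (x y z w p u v : 'rV[R]_4) (xi : R).

(** The coordinates of the exterior product of two points that involve the height,
    in the basis formed by x_0 and the forms [delta1], [delta2], [delta3].  They all
    vanish exactly when the two points are proportional, provided that one of them
    has nonzero height. *)
Definition wedge1 xi x y : R := x 0 0 * delta1 xi y - y 0 0 * delta1 xi x.
Definition wedge2 xi x y : R := x 0 0 * delta2 xi y - y 0 0 * delta2 xi x.
Definition wedge3 xi x y : R := x 0 0 * delta3 xi y - y 0 0 * delta3 xi x.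

Definition parallel xi x y : bool :=
  [&& wedge1 xi x y == 0, wedge2 xi x y == 0 & wedge3 xi x y == 0].

Lemma parallel_sym xi x y : parallel xi x y = parallel xi y x.
Proof.
have e (a b c d : R) : (a * b - c * d == 0) = (c * d - a * b == 0).
  by rewrite -oppr_eq0 opprB.
by rewrite /parallel /wedge1 /wedge2 /wedge3 !(e (x 0 0)).
Qed.

Lemma wedge_lin xi x y a b c d : let u := a *: x + b *: y in
  let v := c *: x + d *: y in
  [/\ wedge1 xi u v = (a * d - b * c) * wedge1 xi x y,
      wedge2 xi u v = (a * d - b * c) * wedge2 xi x y &
      wedge3 xi u v = (a * d - b * c) * wedge3 xi x y].
Proof.
rewrite /wedge1 /wedge2 /wedge3 /delta1 /delta2 /delta3 /=.
by split; rewrite !mxE; ring.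
Qed.

Lemma coplanar_span xi x y z : ~~ parallel xi x y -> coplanar x y z ->
  exists s t, z = s *: x + t *: y.
Proof.
move=> npar /and4P[/eqP n0 /eqP n1 /eqP n2 /eqP n3].
have key M Mz Mx : M != 0 -> (forall l, M * z 0 l = Mz * x 0 l + Mx * y 0 l) ->
    exists s t, z = s *: x + t *: y.
  move=> M0 h; exists (M^-1 * Mz), (M^-1 * Mx).
  by apply/rowP => l; rewrite !mxE -!mulrA -mulrDr -h mulrA mulVf ?mul1r.
rewrite /normal0 /normal1 /normal2 /normal3 /det3 in n0 n1 n2 n3.
have [m1|m1] := eqVneq (x 0 0 * y 0 1 - x 0 1 * y 0 0) 0; last first.
  by apply: (key _ (z 0 0 * y 0 1 - z 0 1 * y 0 0)
    (x 0 0 * z 0 1 - x 0 1 * z 0 0) m1); apply: ord4P; lra.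
have [m2|m2] := eqVneq (x 0 0 * y 0 2 - x 0 2 * y 0 0) 0; last first.
  by apply: (key _ (z 0 0 * y 0 2 - z 0 2 * y 0 0)
    (x 0 0 * z 0 2 - x 0 2 * z 0 0) m2); apply: ord4P; lra.
have [m3|m3] := eqVneq (x 0 0 * y 0 3 - x 0 3 * y 0 0) 0; last first.
  by apply: (key _ (z 0 0 * y 0 3 - z 0 3 * y 0 0)
    (x 0 0 * z 0 3 - x 0 3 * z 0 0) m3); apply: ord4P; lra.
case/negP: npar; rewrite /parallel /wedge1 /wedge2 /wedge3 /delta1 /delta2 /delta3.
apply/and3P; split; apply/eqP; first by lra.
- transitivity ((x 0 0 * y 0 2 - x 0 2 * y 0 0) - xi * (x 0 0 * y 0 1 - x 0 1 * y 0 0)); first by ring.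
  by rewrite m1 m2; ring.
- transitivity ((x 0 0 * y 0 3 - x 0 3 * y 0 0) - xi * (x 0 0 * y 0 2 - x 0 2 * y 0 0)); first by ring.
  by rewrite m2 m3; ring.
Qed.

Lemma norm3_le (a b c A B C : R) : `|a| <= A -> `|b| <= B -> `|c| <= C ->
  `|a - b + c| <= A + B + C.
Proof.
move=> ha hb hc; apply: (le_trans (ler_normD _ _)); apply: lerD => //.
by apply: (le_trans (ler_normB _ _)); apply: lerD.
Qed.

Lemma norm2_le (a b c d A B C D : R) : `|a| <= A -> `|b| <= B -> `|c| <= C ->
  `|d| <= D -> `|a * b - c * d| <= A * B + C * D.
Proof.
move=> ha hb hc hd; apply: (le_trans (ler_normB _ _)).
by rewrite !normrM; apply: lerD; apply: ler_pM.
Qed.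

(** Meant for determinants with heights in the first column only, the entries of the
    other two columns being errors. *)
Lemma det3_bound (a0 a1 a2 b0 b1 b2 c0 c1 c2 : R) (A B C a b c : R) :
  `|a0| <= A -> `|a1| <= a -> `|a2| <= a ->
  `|b0| <= B -> `|b1| <= b -> `|b2| <= b ->
  `|c0| <= C -> `|c1| <= c -> `|c2| <= c ->
  `|det3 a0 a1 a2 b0 b1 b2 c0 c1 c2| <= 2 * (A * b * c + B * a * c + C * a * b).
Proof.
move=> hA h1 h2 hB h3 h4 hC h5 h6.
apply: (@le_trans _ _ (A * (b * c + b * c) + a * (B * c + b * C)
   + a * (B * c + b * C))); last by lra.
by apply: norm3_le; rewrite normrM; apply: ler_pM => //; apply: norm2_le.
Qed.

Lemma det4_delta xi p y z w : det4 p y z w =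
  - det3 (delta1 xi p) (delta2 xi p) (delta3 xi p)
    (delta1 xi y) (delta2 xi y) (delta3 xi y)
    (delta1 xi z) (delta2 xi z) (delta3 xi z) * w 0 0
  + det3 (p 0 0) (delta2 xi p) (delta3 xi p) (y 0 0) (delta2 xi y) (delta3 xi y)
    (z 0 0) (delta2 xi z) (delta3 xi z) * delta1 xi w
  - det3 (p 0 0) (delta1 xi p) (delta3 xi p) (y 0 0) (delta1 xi y) (delta3 xi y)
    (z 0 0) (delta1 xi z) (delta3 xi z) * delta2 xi w
  + det3 (p 0 0) (delta1 xi p) (delta2 xi p) (y 0 0) (delta1 xi y) (delta2 xi y)
    (z 0 0) (delta1 xi z) (delta2 xi z) * delta3 xi w.
Proof.
rewrite /det4 /dot4 /normal0 /normal1 /normal2 /normal3 /delta1 /delta2 /delta3.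
by rewrite /det3; ring.
Qed.

(** The form w |-> det4 p y z w vanishes at [u], so its value at
    (1, xi, xi^2, xi^3) is at most its coefficients times err(u) / height(u).  The
    value at [w] is therefore small, yet it is at least 1. *)
Lemma det4_jump xi p y z u w :
  height p <= height z -> height y <= height z ->
  err xi z <= err xi y -> err xi y <= err xi p ->
  0 < height u -> height u <= height w -> err xi w <= err xi u ->
  det4 p y z u = 0 -> 1 <= `|det4 p y z w| ->
  height u <= 36 * height z * err xi y * err xi p * height w * err xi u.
Proof.
move=> hpz hyz ezy eyp hu huw ewu; rewrite !(det4_delta xi).
set A0 := - det3 _ _ _ _ _ _ _ _ _; set A1 := det3 _ _ _ _ _ _ _ _ _.
set A2 := det3 _ _ _ _ _ _ _ _ _; set A3 := det3 _ _ _ _ _ _ _ _ _.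
set b := 6 * (height z * err xi y * err xi p).
have Z0 : 0 <= height z by exact: normr_ge0.
have [P0 Y0] : 0 <= height p /\ 0 <= height y by split; exact: normr_ge0.
have [ep0 ey0] := (err_ge0 xi p, err_ge0 xi y).
have ez0 := err_ge0 xi z.
have bE : 2 * (height p * err xi y * err xi z + height y * err xi p * err xi z
     + height z * err xi p * err xi y) <= b.
  have h1 : height p * err xi y * err xi z <= height z * err xi y * err xi p.
    apply: ler_pM => //; [exact: mulr_ge0|exact: ler_pM|exact: le_trans eyp].
  have h2 : height y * err xi p * err xi z <= height z * err xi p * err xi y.
    apply: ler_pM => //; [exact: mulr_ge0|exact: ler_pM].
  by rewrite /b; lra.
have A1b : `|A1| <= b.
  by apply: le_trans bE; apply: det3_bound => //; rewrite ?delta2_le ?delta3_le.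
have A2b : `|A2| <= b.
  by apply: le_trans bE; apply: det3_bound => //; rewrite ?delta1_le ?delta3_le.
have A3b : `|A3| <= b.
  by apply: le_trans bE; apply: det3_bound => //; rewrite ?delta1_le ?delta2_le.
have b0 : 0 <= b by exact: le_trans A1b.
clearbody A0 A1 A2 A3 => hdu hdw.
have e0 : `|A0| * height u <= 3 * b * err xi u.
  rewrite /height -normrM.
  have -> : A0 * u 0 0 = - A1 * delta1 xi u - (- A2) * delta2 xi u + - A3 * delta3 xi u.
    by move: hdu; lra.
  have -> : 3 * b * err xi u = b * err xi u + b * err xi u + b * err xi u by ring.
  by apply: norm3_le; rewrite normrM ?normrN; apply: ler_pM => //;
    rewrite ?delta1_le ?delta2_le ?delta3_le.
have e1 : 1 <= `|A0| * height w + 3 * b * err xi w.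
  apply: (le_trans hdw).
  have -> : A0 * w 0 0 + A1 * delta1 xi w - A2 * delta2 xi w + A3 * delta3 xi w
   = A0 * w 0 0 + (A1 * delta1 xi w - A2 * delta2 xi w + A3 * delta3 xi w) by ring.
  apply: (le_trans (ler_normD _ _)); rewrite normrM lerD //.
  have -> : 3 * b * err xi w = b * err xi w + b * err xi w + b * err xi w by ring.
  by apply: norm3_le; rewrite normrM ?normrN; apply: ler_pM => //;
    rewrite ?delta1_le ?delta2_le ?delta3_le.
have W0 : 0 <= height w by exact: normr_ge0.
have e2 : height u * 1 <= height u * (`|A0| * height w + 3 * b * err xi w).
  by apply: ler_wpM2l => //; exact: ltW.
have e3 : height u * `|A0| * height w <= 3 * b * err xi u * height w.
  by apply: ler_wpM2r => //; rewrite mulrC.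
have e4 : 3 * b * (height u * err xi w) <= 3 * b * (height w * err xi u).
  apply: ler_wpM2l; first by lra.
  by apply: ler_pM => //; [exact: ltW|exact: err_ge0].
by rewrite /b in e2 e3 e4 *; lra.
Qed.

(** The cross product of (x_0, x_1, x_2) and (x_1, x_2, x_3): the coefficients of the
    recurrence of order two satisfied by the coordinates of [x]. *)
Definition hankel_a x : R := x 0 1 * x 0 3 - x 0 2 ^+ 2.
Definition hankel_b x : R := x 0 1 * x 0 2 - x 0 0 * x 0 3.
Definition hankel_c x : R := x 0 0 * x 0 2 - x 0 1 ^+ 2.

(** The two components of C(x, y), that is, the determinants of x-, x+ and y- or y+. *)
Definition cov_lo x y : R :=
  hankel_a x * y 0 0 + hankel_b x * y 0 1 + hankel_c x * y 0 2.
Definition cov_hi x y : R :=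
  hankel_a x * y 0 1 + hankel_b x * y 0 2 + hankel_c x * y 0 3.

Lemma cov_lin x a b u v :
  cov_lo x (a *: u + b *: v) = a * cov_lo x u + b * cov_lo x v /\
  cov_hi x (a *: u + b *: v) = a * cov_hi x u + b * cov_hi x v.
Proof. by rewrite /cov_lo /cov_hi !mxE; split; ring. Qed.

Lemma cov_self x : cov_lo x x = 0 /\ cov_hi x x = 0.
Proof.
by rewrite /cov_lo /cov_hi /hankel_a /hankel_b /hankel_c; split; ring.
Qed.

Let dd2 xi x := delta2 xi x - xi * delta1 xi x.
Let dd3 xi x := delta3 xi x - xi * delta2 xi x.

Lemma cov_lo_delta xi x y : cov_lo x y =
  det3 (x 0 0) (delta1 xi x) (delta2 xi x) (delta1 xi x) (dd2 xi x) (dd3 xi x)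
    (y 0 0) (delta1 xi y) (delta2 xi y).
Proof.
by rewrite /cov_lo /hankel_a /hankel_b /hankel_c /det3 /dd2 /dd3 /delta1 /delta2
  /delta3; ring.
Qed.

Lemma cov_hi_delta xi x y : cov_hi x y =
  det3 (x 0 0) (delta1 xi x) (delta2 xi x) (delta1 xi x) (dd2 xi x) (dd3 xi x)
    (y 0 1) (delta2 xi y) (delta3 xi y).
Proof.
by rewrite /cov_hi /hankel_a /hankel_b /hankel_c /det3 /dd2 /dd3 /delta1 /delta2
  /delta3; ring.
Qed.

Lemma cov_err_delta xi x y : cov_hi x y - xi * cov_lo x y =
  det3 (x 0 0) (delta1 xi x) (delta2 xi x) (delta1 xi x) (dd2 xi x) (dd3 xi x)
    (delta1 xi y) (dd2 xi y) (dd3 xi y).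
Proof.
by rewrite /cov_hi /cov_lo /hankel_a /hankel_b /hankel_c /det3 /dd2 /dd3 /delta1
  /delta2 /delta3; ring.
Qed.

Lemma dd_le xi x : `|dd2 xi x| <= (1 + `|xi|) * err xi x /\
  `|dd3 xi x| <= (1 + `|xi|) * err xi x.
Proof.
split; apply: (le_trans (ler_normB _ _)); rewrite normrM mulrDl mul1r;
  apply: lerD; rewrite ?delta2_le ?delta3_le //; apply: ler_wpM2l => //;
  by rewrite ?delta1_le ?delta2_le.
Qed.

Lemma coord1_le xi x : err xi x <= 1 -> 1 <= height x ->
  `|x 0 1| <= (1 + `|xi|) * height x.
Proof.
move=> e1 h1; have -> : x 0 1 = delta1 xi x + xi * x 0 0 by rewrite /delta1; ring.
apply: (le_trans (ler_normD _ _)); rewrite normrM mulrDl mul1r; apply: lerD => //.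
by apply: le_trans h1; apply: le_trans e1; exact: delta1_le.
Qed.

Lemma coord2_le xi x : err xi x <= 1 -> 1 <= height x ->
  `|x 0 2| <= (1 + `|xi|) ^+ 2 * height x.
Proof.
move=> e1 h1; have -> : x 0 2 = delta2 xi x + xi * x 0 1 by rewrite /delta2; ring.
apply: (le_trans (ler_normD _ _)); rewrite normrM.
have := ler_wpM2l (normr_ge0 xi) (coord1_le e1 h1).
have : `|delta2 xi x| <= 1 by apply: le_trans e1; exact: delta2_le.
have := normr_ge0 xi; nra.
Qed.

(** After column operations the determinants have one column of heights and two
    columns of errors.  In the combination of the last bound the height of [y] itself
    is replaced by an error of [y], so C(x, y) is nearly proportional to (1, xi). *)
Lemma cov_le xi x y : err xi x <= 1 -> err xi y <= 1 -> 1 <= height x ->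
  1 <= height y ->
  let b := 4 * (1 + `|xi|) ^+ 2 *
    (height x * err xi x * err xi y + height y * err xi x ^+ 2) in
  [/\ `|cov_lo x y| <= b, `|cov_hi x y| <= b &
  `|cov_hi x y - xi * cov_lo x y| <=
     6 * (1 + `|xi|) ^+ 2 * (height x * err xi x * err xi y)].
Proof.
move=> ex1 ey1 hx hy b; set B := 1 + `|xi|.
have B1 : 1 <= B by rewrite /B lerDl.
have [ex0 ey0] := (err_ge0 xi x, err_ge0 xi y).
have [dx2 dx3] := dd_le xi x; have [dy2 dy3] := dd_le xi y.
set ex := err xi x in ex1 ex0 dx2 dx3 b *; set ey := err xi y in ey1 ey0 dy2 dy3 b *.
set X := height x in hx b *; set Y := height y in hy b *.
have m1 : ex * ex * ey <= B * (X * ex * ey).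
  have : 0 <= ex * ey by exact: mulr_ge0.
  have : ex <= B * X by nra.
  by move=> h1 h2; have := ler_wpM2r h2 h1; lra.
have q0 : 0 <= X * ex * ey by do !apply: mulr_ge0 => //; lra.
have r0 : 0 <= Y * ex * ex by do !apply: mulr_ge0 => //; lra.
have BB : B <= B ^+ 2 by nra.
have r1 : 0 <= B * (Y * ex * ex) by apply: mulr_ge0 => //; lra.
have q1 : 0 <= B * (X * ex * ey) by apply: mulr_ge0 => //; lra.
have m2 : B * (X * ex * ey) <= B ^+ 2 * (X * ex * ey) by apply: ler_wpM2r.
have m3 : B * (Y * ex * ex) <= B ^+ 2 * (Y * ex * ex) by apply: ler_wpM2r.
split.
- rewrite (cov_lo_delta xi); apply: le_trans (det3_bound (lexx _) (delta1_le _ _)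
   (delta2_le _ _) (delta1_le _ _) dx2 dx3 (lexx _) (delta1_le _ _) (delta2_le _ _)) _.
  by rewrite -/ex -/ey /b -/X -/Y -/B -[`|x 0 0|]/X -[`|y 0 0|]/Y; lra.
- rewrite (cov_hi_delta xi); apply: le_trans (det3_bound (lexx _) (delta1_le _ _)
   (delta2_le _ _) (delta1_le _ _) dx2 dx3 (coord1_le ey1 hy) (delta2_le _ _) (delta3_le _ _)) _.
  by rewrite -/ex -/ey /b -/X -/Y -/B -[`|x 0 0|]/X; lra.
- rewrite cov_err_delta; apply: le_trans (det3_bound (lexx _) (delta1_le _ _)
   (delta2_le _ _) (delta1_le _ _) dx2 dx3 (delta1_le _ _) dy2 dy3) _.
  have m4 : B * (ex * ex * ey) <= B * (B * (X * ex * ey)) by apply: ler_wpM2l => //; lra.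
  by rewrite -/ex -/ey -/B -/X -[`|x 0 0|]/X; lra.
Qed.
End Estimates.

(** * Points of rank one and recurrences of order two *)

Section Arithmetic.
Variable R : realType.
Implicit Types (x y z w : 'rV[R]_4) (xi : R).

(** Division by the gcd, with a Bezout relation between the quotients. *)
Lemma bezout_div (m n : int) : m != 0 \/ n != 0 -> exists g q p u v : int,
  [/\ g != 0, m = q * g, n = p * g & u * q + v * p = 1].
Proof.
move=> mn0; pose g := gcdz m n.
have g0 : g != 0.
  by rewrite gcdz_eq0; case: mn0 => /negbTE ->; rewrite ?andbF.
have /dvdzP[q qE] : (g %| m)%Z by exact: dvdz_gcdl.
have /dvdzP[p pE] : (g %| n)%Z by exact: dvdz_gcdr.
have [u [v uv]] := Bezoutz m n.
exists g, q, p, u, v; split => //; apply: (mulIf g0).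
by rewrite mul1r mulrDl -!mulrA -qE -pE.
Qed.

(** The coordinates form a geometric progression of ratio p / q in lowest terms, so
    q^3 divides x_0. *)
Lemma rank_one_ratio x : integral_point x -> x 0 0 != 0 ->
  hankel_b x = 0 -> hankel_c x = 0 ->
  exists p q : R, [/\ p \is a Num.int, q \is a Num.int, q != 0 &
    `|q| ^+ 3 <= height x] /\
    [/\ q * x 0 1 = p * x 0 0, q * x 0 2 = p * x 0 1 & q * x 0 3 = p * x 0 2].
Proof.
rewrite /hankel_b /hankel_c /height => hx.
have /intrP[m0 ->] := hx 0; have /intrP[m1 ->] := hx 1.
have /intrP[m2 ->] := hx 2; have /intrP[m3 ->] := hx 3.
rewrite intr_eq0 => m0_neq0 hb hc.
have {}hc : m0 * m2 = m1 ^+ 2.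
  by apply: (@intr_inj R); rewrite rmorphM rmorphXn /=; lra.
have {}hb : m1 * m2 = m0 * m3.
  by apply: (@intr_inj R); rewrite !rmorphM /=; lra.
have [g [q [p [u [v [g0 qE pE uv]]]]]] := bezout_div (or_introl m0_neq0 : _ \/ m1 != 0).
have cop : coprimez q p by apply/coprimezP; exists (u, v).
have q0 : q != 0 by apply: contraNneq m0_neq0 => q0; rewrite qE q0 mul0r.
have e2 : q * m2 = g * p ^+ 2.
  by apply: (mulfI g0); rewrite mulrA (mulrC g) -qE hc pE; ring.
have /dvdzP[g1 g1E] : (q %| g)%Z.
  by rewrite -(@Gauss_dvdzl q g (p ^+ 2)) ?coprimezXr // -e2 dvdz_mulr.
have e2' : m2 = g1 * p ^+ 2.
  by apply: (mulfI q0); rewrite e2 g1E; ring.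
have e3 : q * m3 = g1 * p ^+ 3.
  by apply: (mulfI g0); rewrite mulrA (mulrC g) -qE -hb e2' pE; ring.
have /dvdzP[g2 g2E] : (q %| g1)%Z.
  by rewrite -(@Gauss_dvdzl q g1 (p ^+ 3)) ?coprimezXr // -e3 dvdz_mulr.
exists p%:~R, q%:~R; split; first split.
- exact: intr_int.
- exact: intr_int.
- by rewrite intr_eq0.
- have -> : m0 = g2 * q ^+ 3 by rewrite qE g1E g2E; ring.
  rewrite rmorphM rmorphXn /= normrM normrX ler_peMl ?exprn_ge0 //.
  apply: norm_intr_ge1; first exact: intr_int.
  by rewrite intr_eq0; apply: contraNneq g0 => h; rewrite g1E g2E h !mul0r.
- split; rewrite -!rmorphM /=; congr (_ %:~R).
  + by rewrite qE pE; ring.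
  + by rewrite e2 pE; ring.
  + by rewrite e3 e2'; ring.
Qed.

(** The point [x] is a multiple of (q^3, q^2 p, q p^2, p^3) with |q|^3 <= height(x).
    The integers q w_k - p w_(k-1) are bounded by a multiple of |q| err(w), and they
    do not all vanish, since otherwise [w] would be proportional to [x]. *)
Lemma rank_one_bound xi x w : integral_point x -> integral_point w ->
  hankel_b x = 0 -> hankel_c x = 0 -> ~~ parallel xi x w ->
  1 <= height w -> height w <= height x -> err xi w <= 1 -> err xi x <= err xi w ->
  1 <= 8 * (1 + `|xi|) ^+ 6 * (height x * err xi w ^+ 3).
Proof.
move=> hx hw hb hc npar w1 wx ew exw.
have X0 : 0 < height x by lra.
have x0 : x 0 0 != 0 by rewrite -normr_gt0.
have [p [q [[ip iq q0 q3] [r1 r2 r3]]]] := rank_one_ratio hx x0 hb hc.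
set B := 1 + `|xi|; have B1 : 1 <= B by rewrite /B lerDl.
have W0 : 0 <= height w by lra.
have ew0 := err_ge0 xi w.
have B2 : B <= B ^+ 2 by nra.
have hq : `|q * xi - p| * height x <= `|q| * err xi w.
  rewrite /height -normrM.
  have -> : (q * xi - p) * x 0 0 = - (q * delta1 xi x).
    by rewrite /delta1 mulrBr r1; ring.
  by rewrite normrN normrM; apply: ler_wpM2l => //; exact: le_trans (delta1_le _ _) _.
have bound (a d : R) : `|a| <= B ^+ 2 * height w -> `|d| <= err xi w ->
    `|q * d + (q * xi - p) * a| <= 2 * B ^+ 2 * (`|q| * err xi w).
  move=> ha hd; apply: le_trans (ler_normD _ _) _; rewrite !normrM.
  have h1 : `|q| * `|d| <= `|q| * err xi w by exact: ler_wpM2l.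
  have h2 : `|q * xi - p| * `|a| <= `|q * xi - p| * (B ^+ 2 * height x).
    apply: ler_wpM2l => //; apply: (le_trans ha); apply: ler_wpM2l => //.
    exact: exprn_ge0 (le_trans ler01 B1).
  have h3 : B ^+ 2 * (`|q * xi - p| * height x) <= B ^+ 2 * (`|q| * err xi w).
    by apply: ler_wpM2l => //; exact: exprn_ge0 (le_trans ler01 B1).
  have h4 : `|q| * err xi w <= B ^+ 2 * (`|q| * err xi w).
    by rewrite ler_peMl ?mulr_ge0 //; nra.
  by lra.
have small : (1 <= 2 * B ^+ 2 * (`|q| * err xi w)) \/
   [/\ q * w 0 1 = p * w 0 0, q * w 0 2 = p * w 0 1 & q * w 0 3 = p * w 0 2].
  have key (a b : R) : a \is a Num.int -> b \is a Num.int ->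
     `|a| <= B ^+ 2 * height w -> `|b - xi * a| <= err xi w ->
     1 <= 2 * B ^+ 2 * (`|q| * err xi w) \/ q * b = p * a.
    move=> ia ib ha hb'; have [h|h] := eqVneq (q * b - p * a) 0.
      by right; apply/eqP; rewrite -subr_eq0 h.
    left; apply: le_trans (bound _ _ ha hb').
    have -> : q * (b - xi * a) + (q * xi - p) * a = q * b - p * a by ring.
    by apply: norm_intr_ge1 h; rewrite rpredB // rpredM.
  have hw0 : `|w 0 0| <= B ^+ 2 * height w.
    rewrite -/(height w); have : 1 * height w <= B ^+ 2 * height w.
      by apply: ler_wpM2r => //; nra.
    by rewrite mul1r.
  have hw1 : `|w 0 1| <= B ^+ 2 * height w.
    by apply: le_trans (coord1_le ew w1) _; apply: ler_wpM2r.
  case: (key _ _ (hw 0) (hw 1) hw0 (delta1_le xi w)); first by left.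
  case: (key _ _ (hw 1) (hw 2) hw1 (delta2_le xi w)); first by left.
  case: (key _ _ (hw 2) (hw 3) (coord2_le ew w1) (delta3_le xi w)); first by left.
  by right; split.
case: small => [h|[s1 s2 s3]]; last first.
  case/negP: npar; rewrite /parallel /wedge1 /wedge2 /wedge3 /delta1 /delta2 /delta3.
  have geom (a b : R) : q * b = p * a -> b = p / q * a.
    by move=> h; apply: (mulfI q0); rewrite h; field.
  rewrite (geom _ _ r3) (geom _ _ s3) (geom _ _ r2) (geom _ _ s2) (geom _ _ r1) (geom _ _ s1).
  by apply/and3P; split; apply/eqP; ring.
have : 1 ^+ 3 <= (2 * B ^+ 2 * (`|q| * err xi w)) ^+ 3 by rewrite lerXn2r // nnegrE; lra.
rewrite expr1n => h3; apply: (le_trans h3).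
have -> : (2 * B ^+ 2 * (`|q| * err xi w)) ^+ 3 =
  8 * B ^+ 6 * (`|q| ^+ 3 * err xi w ^+ 3) by ring.
apply: ler_wpM2l; first by rewrite mulr_ge0 // exprn_ge0 //; lra.
by apply: ler_wpM2r => //; exact: exprn_ge0.
Qed.

Lemma primitive_triple (a b c : R) : a \is a Num.int -> b \is a Num.int ->
  c \is a Num.int -> ~ (a = 0 /\ b = 0 /\ c = 0) ->
  exists g a' b' c' u v w : R, [/\ g != 0, a = a' * g, b = b' * g & c = c' * g] /\
   [/\ a' \is a Num.int, b' \is a Num.int & c' \is a Num.int] /\
   [/\ u \is a Num.int, v \is a Num.int, w \is a Num.int
     & u * a' + v * b' + w * c' = 1].
Proof.
move=> /intrP[a0 ->] /intrP[b0 ->] /intrP[c0 ->] abc.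
have [ab|ab] := pselect (a0 != 0 \/ b0 != 0).
  have [g [q [p [u [v [g0 qE pE uv]]]]]] := bezout_div ab.
  have [h [r [s [t [k [h0 rE sE tk]]]]]] := bezout_div (or_introl g0 : _ \/ c0 != 0).
  exists h%:~R, (q * r)%:~R, (p * r)%:~R, s%:~R, (t * u)%:~R, (t * v)%:~R, k%:~R.
  rewrite intr_eq0 -!rmorphM -!rmorphD !intr_int; split.
    by rewrite -!mulrA -rE -qE -pE -sE.
  split => //; split => //; have -> : t * u * (q * r) + t * v * (p * r) + k * s =
    t * r * (u * q + v * p) + k * s by ring.
  by rewrite uv mulr1 tk.
have [a00 b00] : a0 = 0 /\ b0 = 0.
  by split; apply/eqP; apply: contrapT => /negP ?; apply: ab; [left|right].
have c00 : c0 != 0 by apply/eqP => c00; apply: abc; rewrite a00 b00 c00.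
exists c0%:~R, 0, 0, 1, 0, 0, 1; rewrite a00 b00 intr_eq0.
rewrite !mul0r mul1r !rpred0 !rpred1.
by split; [|split; [|split; [| | |ring]]].
Qed.

(** The coordinates of [x] satisfy the recurrence a x_k + b x_(k+1) + c x_(k+2) = 0. *)
Definition annihilates (a b c : R) x : Prop :=
  a * x 0 0 + b * x 0 1 + c * x 0 2 = 0 /\
  a * x 0 1 + b * x 0 2 + c * x 0 3 = 0.

Lemma annihilates_lin a b c s t x y : annihilates a b c x -> annihilates a b c y ->
  annihilates a b c (s *: x + t *: y).
Proof.
rewrite /annihilates !mxE => -[x1 x2] [y1 y2]; split.
- transitivity (s * (a * x 0 0 + b * x 0 1 + c * x 0 2) +
    t * (a * y 0 0 + b * y 0 1 + c * y 0 2)); first by ring.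
  by rewrite x1 y1 !mulr0 addr0.
- transitivity (s * (a * x 0 1 + b * x 0 2 + c * x 0 3) +
    t * (a * y 0 1 + b * y 0 2 + c * y 0 3)); first by ring.
  by rewrite x2 y2 !mulr0 addr0.
Qed.

(** The solutions of a recurrence of order two form a plane: the vectors (a, b, c, 0)
    and (0, a, b, c) are independent and cannot both be proportional to the normal
    vector unless it is zero. *)
Lemma annihilates_coplanar a b c x y z : ~ (a = 0 /\ b = 0 /\ c = 0) ->
  annihilates a b c x -> annihilates a b c y -> annihilates a b c z ->
  coplanar x y z.
Proof.
move=> abc [x1 x2] [y1 y2] [z1 z2].
have o1 w : a * w 0 0 + b * w 0 1 + c * w 0 2 = 0 -> dot4 a b c 0 w = 0.
  by rewrite /dot4 mul0r addr0.
have o2 w : a * w 0 1 + b * w 0 2 + c * w 0 3 = 0 -> dot4 0 a b c w = 0.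
  by rewrite /dot4 mul0r add0r.
have := normal_proportional (o1 _ x1) (o1 _ y1) (o1 _ z1).
have := normal_proportional (o2 _ x2) (o2 _ y2) (o2 _ z2).
rewrite /coplanar /=; move: (normal0 x y z) (normal1 x y z) (normal2 x y z)
  (normal3 x y z) => n0 n1 n2 n3.
rewrite !mul0r => -[[f01 f02 f03] [f12 f13 f23]] [[e01 e02 e03] [e12 e13 e23]].
have cancel3 n : a * n = 0 -> b * n = 0 -> c * n = 0 -> n = 0.
  move=> /eqP ha /eqP hb /eqP hc; apply/eqP; apply: contrapT => /negP n0'.
  apply: abc; move: ha hb hc; rewrite !mulf_eq0 (negbTE n0') !orbF.
  by move=> /eqP -> /eqP -> /eqP ->.
have h3 : n3 = 0 by apply: cancel3; lra.
have h0 : n0 = 0 by apply: cancel3; lra.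
rewrite h0 h3 in e01 e02 e03 e12 e13 e23 f01 f02 f03 f12 f13 f23 *.
have h1 : n1 = 0 by apply: cancel3; lra.
have h2 : n2 = 0 by apply: cancel3; lra.
by rewrite h1 h2 eqxx.
Qed.
End Arithmetic.

(** * Planes annihilated by a recurrence *)

Lemma intB (R : realType) (s t : R) : s \is a Num.int -> t \is a Num.int -> s - t \is a Num.int.
Proof. exact: rpredB. Qed.
Lemma intD (R : realType) (s t : R) : s \is a Num.int -> t \is a Num.int -> s + t \is a Num.int.
Proof. exact: rpredD. Qed.
Lemma intM (R : realType) (s t : R) : s \is a Num.int -> t \is a Num.int -> s * t \is a Num.int.
Proof. exact: rpredM. Qed.
Lemma intX (R : realType) (s : R) n : s \is a Num.int -> s ^+ n \is a Num.int.
Proof. exact: rpredX. Qed.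

Ltac prove_int := repeat first
  [ assumption | apply: intB | apply: intD | apply: intM | apply: intX
  | exact: intr_nat | match goal with h : integral_point ?x |- _ => exact: h end ].

Section Special.
Variable R : realType.
Implicit Types (x y z w p : 'rV[R]_4) (xi : R).

(** The cross product of two vectors orthogonal to (a, b, c) is a multiple of
    (a, b, c), and the Bezout coefficients exhibit the multiplier: it is an integer if
    all the data are. *)
Lemma kernel2_cross (a b c u v w x0 x1 x2 y0 y1 y2 : R) :
  a * x0 + b * x1 + c * x2 = 0 -> a * y0 + b * y1 + c * y2 = 0 ->
  u * a + v * b + w * c = 1 ->
  let m := u * (x1 * y2 - x2 * y1) - v * (x0 * y2 - x2 * y0)
         + w * (x0 * y1 - x1 * y0) in
  [/\ x1 * y2 - x2 * y1 = m * a, x0 * y2 - x2 * y0 = - (m * b)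
    & x0 * y1 - x1 * y0 = m * c].
Proof.
move=> hx hy h1 m.
set m12 := x1 * y2 - x2 * y1; set m02 := x0 * y2 - x2 * y0.
set m01 := x0 * y1 - x1 * y0.
have r1 : a * m01 = c * m12.
  transitivity ((a * x0 + b * x1 + c * x2) * y1 - (a * y0 + b * y1 + c * y2) * x1
    + c * m12); first by rewrite /m01 /m12; ring.
  by rewrite hx hy; ring.
have r2 : b * m01 = - (c * m02).
  transitivity (- (a * x0 + b * x1 + c * x2) * y0 + (a * y0 + b * y1 + c * y2) * x0
    - c * m02); first by rewrite /m01 /m02; ring.
  by rewrite hx hy; ring.
have r3 : a * m02 = - (b * m12).
  transitivity ((a * x0 + b * x1 + c * x2) * y2 - (a * y0 + b * y1 + c * y2) * x2
    - b * m12); first by rewrite /m02 /m12; ring.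
  by rewrite hx hy; ring.
have mE : m = u * m12 - v * m02 + w * m01 by [].
split.
- transitivity ((u * a + v * b + w * c) * m12); first by rewrite h1; ring.
  transitivity (u * a * m12 + v * (b * m12) + w * (c * m12)); first by ring.
  by rewrite -r1 -[b * m12]opprK -r3 mE; ring.
- transitivity ((u * a + v * b + w * c) * m02); first by rewrite h1; ring.
  transitivity (u * (a * m02) + v * b * m02 + w * (c * m02)); first by ring.
  by rewrite -[c * m02]opprK -r2 r3 mE; ring.
- transitivity ((u * a + v * b + w * c) * m01); first by rewrite h1; ring.
  transitivity (u * (a * m01) + v * (b * m01) + w * c * m01); first by ring.
  by rewrite r1 r2 mE; ring.
Qed.

(** The Pluecker coordinates of the plane of solutions of a primitive recurrence are
    a^2, ab, ac, b^2 - ac, bc, c^2, and these have greatest common divisor 1; so the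
    exterior product of two integral solutions is an integral multiple of them. *)
Lemma annihilated_plane (a b c u v w : R) x y :
  a \is a Num.int -> b \is a Num.int -> c \is a Num.int ->
  u \is a Num.int -> v \is a Num.int -> w \is a Num.int ->
  u * a + v * b + w * c = 1 ->
  integral_point x -> integral_point y ->
  annihilates a b c x -> annihilates a b c y ->
  exists2 m : R, m \is a Num.int &
  [/\ x 0 0 * y 0 1 - x 0 1 * y 0 0 = m * c ^+ 2,
      x 0 0 * y 0 2 - x 0 2 * y 0 0 = - (m * (b * c)),
      x 0 0 * y 0 3 - x 0 3 * y 0 0 = m * (b ^+ 2 - a * c)
    & x 0 2 * y 0 3 - x 0 3 * y 0 2 = m * a ^+ 2].
Proof.
move=> ia ib ic iu iv iw h1 ix iy [x1 x2] [y1 y2].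
have [] := kernel2_cross x1 y1 h1; have [] := kernel2_cross x2 y2 h1.
set nu := _ + w * (x 0 1 * y 0 2 - x 0 2 * y 0 1).
set mu := _ + w * (x 0 0 * y 0 1 - x 0 1 * y 0 0).
have imu : mu \is a Num.int by rewrite /mu; prove_int.
have inu : nu \is a Num.int by rewrite /nu; prove_int.
clearbody mu nu => n1 n2 n3 m1 m2 m3.
have mn : mu * a = nu * c by rewrite -m1 -n3.
set m03 := x 0 0 * y 0 3 - x 0 3 * y 0 0.
have im : m03 \is a Num.int by rewrite /m03; prove_int.
have c03 : c * m03 = mu * (b ^+ 2 - a * c).
  transitivity ((a * y 0 1 + b * y 0 2 + c * y 0 3) * x 0 0
    - (a * x 0 1 + b * x 0 2 + c * x 0 3) * y 0 0
    - a * (x 0 0 * y 0 1 - x 0 1 * y 0 0) - b * (x 0 0 * y 0 2 - x 0 2 * y 0 0)).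
    by rewrite /m03; ring.
  by rewrite x2 y2 m3 m2; ring.
have a03 : a * m03 = nu * (b ^+ 2 - a * c).
  transitivity ((a * x 0 0 + b * x 0 1 + c * x 0 2) * y 0 3
    - (a * y 0 0 + b * y 0 1 + c * y 0 2) * x 0 3
    - b * (x 0 1 * y 0 3 - x 0 3 * y 0 1) - c * (x 0 2 * y 0 3 - x 0 3 * y 0 2)).
    by rewrite /m03; ring.
  by rewrite x1 y1 n1 n2; ring.
pose s := u ^+ 2 * a + 2 * u * v * b + 2 * u * w * c + v ^+ 2 * c.
pose t := 2 * v * w * b + w ^+ 2 * c.
(* The square of the Bezout relation, sorted by the generators
   b^2 - ac, a and c. *)
have one : v ^+ 2 * (b ^+ 2 - a * c) + s * a + t * c = 1.
  by rewrite -[RHS](expr1n _ 2) -h1 /s /t; ring.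
exists (v ^+ 2 * m03 + s * nu + t * mu).
  by rewrite /s /t; prove_int.
have hc : (v ^+ 2 * m03 + s * nu + t * mu) * c = mu.
  transitivity (v ^+ 2 * (c * m03) + s * (nu * c) + t * mu * c); first by ring.
  rewrite c03 -mn -[RHS]mulr1 -one; ring.
have ha : (v ^+ 2 * m03 + s * nu + t * mu) * a = nu.
  transitivity (v ^+ 2 * (a * m03) + s * nu * a + t * (mu * a)); first by ring.
  rewrite a03 mn -[RHS]mulr1 -one; ring.
split.
- by rewrite m3 -[in LHS]hc; ring.
- by rewrite m2 -[in LHS]hc; ring.
- rewrite -[LHS]mul1r -one.
  transitivity (v ^+ 2 * m03 * (b ^+ 2 - a * c) + s * (a * m03) + t * (c * m03)); first by ring.
  by rewrite a03 c03; ring.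
- by rewrite n1 -[in LHS]ha; ring.
Qed.

Lemma wedge_le xi x y : height x <= height y -> err xi y <= err xi x ->
  [/\ `|wedge1 xi x y| <= 2 * (height y * err xi x),
      `|wedge2 xi x y| <= 2 * (height y * err xi x)
    & `|wedge3 xi x y| <= 2 * (height y * err xi x)].
Proof.
move=> hxy exy.
have key (d e : R) : `|d| <= err xi y -> `|e| <= err xi x ->
    `|x 0 0 * d - y 0 0 * e| <= 2 * (height y * err xi x).
  move=> hd he.
  have -> : 2 * (height y * err xi x) = height y * err xi x + height y * err xi x by ring.
  by apply: norm2_le => //; exact: le_trans hd exy.
by split; apply: key; rewrite ?delta1_le ?delta2_le ?delta3_le.
Qed.

(** A bound for some coordinates of the exterior product of two points: the largest
    contribution is the height of the second times the error of the first. *)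
Lemma minors_le xi x y : height x <= height y -> err xi y <= err xi x ->
  err xi x <= 1 -> 1 <= height x ->
  let b := 2 * (1 + `|xi|) ^+ 2 * (height y * err xi x) in
  [/\ `|x 0 0 * y 0 1 - x 0 1 * y 0 0| <= b,
      `|x 0 0 * y 0 3 - x 0 3 * y 0 0| <= b &
      `|x 0 2 * y 0 3 - x 0 3 * y 0 2| <= b].
Proof.
move=> hxy exy ex hx b; rewrite /b; have [w1 w2 w3] := wedge_le hxy exy.
set B := 1 + `|xi|; have n0 := normr_ge0 xi.
have ey : err xi y <= 1 by exact: le_trans ex.
have hy : 1 <= height y by exact: le_trans hxy.
set H := height y * err xi x in w1 w2 w3 *.
have H0 : 0 <= H by rewrite mulr_ge0 ?err_ge0 // ltW // (lt_le_trans ltr01).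
have BH : 0 <= `|xi| * H by exact: mulr_ge0.
have BBH : 0 <= `|xi| ^+ 2 * H by rewrite mulr_ge0 // exprn_ge0.
split.
- have -> : x 0 0 * y 0 1 - x 0 1 * y 0 0 = wedge1 xi x y.
    by rewrite /wedge1 /delta1; ring.
  by apply: (le_trans w1); rewrite /B; lra.
- have -> : x 0 0 * y 0 3 - x 0 3 * y 0 0 =
      wedge3 xi x y + xi * wedge2 xi x y + xi * xi * wedge1 xi x y.
    by rewrite /wedge1 /wedge2 /wedge3 /delta1 /delta2 /delta3; ring.
  apply: (le_trans (ler_normD _ _)); rewrite -[xi * xi * _]mulrA !normrM.
  have h := ler_normD (wedge3 xi x y) (xi * wedge2 xi x y); rewrite normrM in h.
  have h1 := ler_wpM2l n0 w2; have h2 := ler_wpM2l n0 (ler_wpM2l n0 w1).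
  by rewrite /B; lra.
- have -> : x 0 2 * y 0 3 - x 0 3 * y 0 2 = x 0 2 * delta3 xi y - y 0 2 * delta3 xi x.
    by rewrite /delta3; ring.
  have -> : 2 * B ^+ 2 * H = (B ^+ 2 * height y) * err xi x + (B ^+ 2 * height y) * err xi x.
    by rewrite /H; ring.
  apply: norm2_le.
  + apply: le_trans (coord2_le ex hx) _; apply: ler_wpM2l => //.
  + exact: le_trans (delta3_le _ _) exy.
  + exact: coord2_le.
  + exact: delta3_le.
Qed.

(** The quadratic polynomial a + b T + c T^2 takes a small value at [xi] because it
    annihilates [y]; hence the recurrence nearly holds at [x]. *)
Lemma quadratic_value_le xi (a b c A : R) x y : annihilates a b c y ->
  `|a| <= A -> `|b| <= A -> `|c| <= A ->
  1 <= height x -> err xi x <= 1 ->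
  height x <= height y -> err xi y <= err xi x ->
  `|a * x 0 0 + b * x 0 1 + c * x 0 2| <= 4 * (1 + `|xi|) ^+ 2 * (A * err xi x) /\
  `|a * x 0 1 + b * x 0 2 + c * x 0 3| <= 4 * (1 + `|xi|) ^+ 2 * (A * err xi x).
Proof.
move=> [y1 _] ha hb hc hx ex hxy exy.
set B := 1 + `|xi|; have B1 : 1 <= B by rewrite /B lerDl.
have A0 : 0 <= A by exact: le_trans ha.
have ex0 := err_ge0 xi x; have ey0 := err_ge0 xi y.
have n0 := normr_ge0 xi.
set Q := a + b * xi + c * xi ^+ 2.
have tail d d' e : `|d| <= e -> `|d'| <= e -> `|b * d + c * (xi * d + d')| <= 2 * B * (A * e).
  move=> hd hd'; apply: (le_trans (ler_normD _ _)); rewrite !normrM.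
  have h1 : `|b| * `|d| <= A * e by apply: ler_pM.
  have h2 : `|xi * d + d'| <= B * e.
    apply: (le_trans (ler_normD _ _)); rewrite normrM /B mulrDl mul1r addrC lerD //.
    exact: ler_wpM2l.
  have h3 : `|c| * `|xi * d + d'| <= A * (B * e) by apply: ler_pM.
  have e0 : 0 <= e by exact: le_trans hd.
  have : 0 <= A * e by exact: mulr_ge0.
  by move=> h4; have : 0 <= (B - 1) * (A * e); [apply: mulr_ge0 => //; lra|lra].
have Qy : `|Q| * height y <= 2 * B * (A * err xi y).
  rewrite -normrM -normrN.
  have -> : - (Q * y 0 0) = b * delta1 xi y + c * (xi * delta1 xi y + delta2 xi y)
    - (a * y 0 0 + b * y 0 1 + c * y 0 2).
    by rewrite /Q /delta1 /delta2; ring.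
  by rewrite y1 subr0; apply: tail; rewrite ?delta1_le ?delta2_le.
have Qx : `|Q| * height x <= 2 * B * (A * err xi x).
  apply: (@le_trans _ _ (`|Q| * height y)); first exact: ler_wpM2l.
  apply: (le_trans Qy); apply: ler_wpM2l; first by lra.
  exact: ler_wpM2l.
have AE : 0 <= A * err xi x by exact: mulr_ge0.
have h5 : 0 <= (B - 1) * (A * err xi x) by apply: mulr_ge0 => //; lra.
have h6 : 0 <= B * ((B - 1) * (A * err xi x)) by apply: mulr_ge0 => //; lra.
split.
- have -> : a * x 0 0 + b * x 0 1 + c * x 0 2 =
     Q * x 0 0 + (b * delta1 xi x + c * (xi * delta1 xi x + delta2 xi x)).
    by rewrite /Q /delta1 /delta2; ring.
  apply: (le_trans (ler_normD _ _)); rewrite normrM -/(height x).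
  have := tail _ _ _ (delta1_le xi x) (delta2_le xi x); lra.
- have -> : a * x 0 1 + b * x 0 2 + c * x 0 3 =
     Q * x 0 1 + (b * delta2 xi x + c * (xi * delta2 xi x + delta3 xi x)).
    by rewrite /Q /delta2 /delta3; ring.
  apply: (le_trans (ler_normD _ _)); rewrite normrM.
  have := tail _ _ _ (delta2_le xi x) (delta3_le xi x).
  have := ler_wpM2l (normr_ge0 Q) (coord1_le ex hx); rewrite -/B.
  have B0 : 0 <= B by lra.
  have := ler_wpM2l B0 Qx; lra.
Qed.

(** By [annihilated_plane] the squares of the coefficients of the primitive recurrence
    are bounded by the area of the plane, about height(z) err(y).  The recurrence does
    not annihilate [p], so [quadratic_value_le] gives an integer of absolute value at
    least 1 that is bounded by the coefficients times err(p). *)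
Lemma special_bound xi (a b c : R) p y z :
  a \is a Num.int -> b \is a Num.int -> c \is a Num.int ->
  ~ (a = 0 /\ b = 0 /\ c = 0) ->
  integral_point p -> integral_point y -> integral_point z ->
  annihilates a b c y -> annihilates a b c z ->
  ~~ parallel xi y z -> ~~ coplanar p y z ->
  1 <= height p -> height p <= height y -> height y <= height z ->
  err xi z <= err xi y -> err xi y <= err xi p -> err xi p <= 1 ->
  1 <= 64 * (1 + `|xi|) ^+ 6 * (height z * err xi y * err xi p ^+ 2).
Proof.
move=> ia ib ic abc ip iy iz ay az npar ncop p1 hpy hyz ezy eyp ep.
have [g [a' [b' [c' [u [v [w [[g0 aE bE cE] [[ia' ib' ic'] [iu iv iw uvw]]]]]]]]]] :=
  primitive_triple ia ib ic abc.
have prim x : annihilates a b c x -> annihilates a' b' c' x.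
  rewrite /annihilates aE bE cE => -[h1 h2]; split; apply: (mulfI g0);
   rewrite mulr0; [rewrite -h1|rewrite -h2]; ring.
move: (prim _ ay) (prim _ az) => {}ay {}az.
have abc' : ~ (a' = 0 /\ b' = 0 /\ c' = 0).
  by move=> [h1 [h2 h3]]; apply: abc; rewrite aE bE cE h1 h2 h3 mul0r.
have ey : err xi y <= 1 by exact: le_trans ep.
have y1 : 1 <= height y by exact: le_trans hpy.
have [m im [m01 m02 m03 m23]] := annihilated_plane ia' ib' ic' iu iv iw uvw iy iz ay az.
have m0 : m != 0.
  apply/eqP => m0; case/negP: npar.
  rewrite m0 !mul0r ?oppr0 in m01 m02 m03.
  rewrite /parallel /wedge1 /wedge2 /wedge3 /delta1 /delta2 /delta3.
  apply/and3P; split; apply/eqP.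
  - by rewrite -[RHS]m01; ring.
  - by transitivity ((y 0 0 * z 0 2 - y 0 2 * z 0 0) -
      xi * (y 0 0 * z 0 1 - y 0 1 * z 0 0)); [ring|rewrite m01 m02; ring].
  - by transitivity ((y 0 0 * z 0 3 - y 0 3 * z 0 0) -
      xi * (y 0 0 * z 0 2 - y 0 2 * z 0 0)); [ring|rewrite m03 m02; ring].
have m1 : 1 <= `|m| by exact: norm_intr_ge1.
set B := 1 + `|xi|; have B1 : 1 <= B by rewrite /B lerDl.
have [] := minors_le hyz ezy ey y1.
set H := height z * err xi y; rewrite -/B m01 m03 m23 (normrM m) (normrM m (_ - _)) (normrM m (a' ^+ 2)) => b1 b2 b3.
have big (t M : R) : `|m| * `|t| <= M -> `|t| <= M.
  by move=> h; apply: le_trans h; rewrite ler_peMl.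
have {b1} b1 := big _ _ b1; have {b2} b2 := big _ _ b2; have {b3} b3 := big _ _ b3.
set M := 2 * B ^+ 2 * H in b1 b2 b3.
have c2 : c' ^+ 2 <= M by exact: le_trans (ler_norm _) b1.
have a2 : a' ^+ 2 <= M by exact: le_trans (ler_norm _) b3.
have b2' : b' ^+ 2 <= 2 * M.
  have h : b' ^+ 2 - a' * c' <= M by exact: le_trans (ler_norm _) b2.
  have : 0 <= (a' - c') ^+ 2 by exact: sqr_ge0.
  by lra.
have M0 : 0 <= M by exact: le_trans (sqr_ge0 _) a2.
set A := Num.sqrt (2 * M).
have AA : A ^+ 2 = 2 * M by rewrite sqr_sqrtr //; lra.
have leA t : t ^+ 2 <= 2 * M -> `|t| <= A.
  by move=> h; rewrite -sqrtr_sqr ler_wsqrtr.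
have a2' : a' ^+ 2 <= 2 * M by lra.
have c2' : c' ^+ 2 <= 2 * M by lra.
have [v1 v2] := quadratic_value_le ay (leA _ a2') (leA _ b2') (leA _ c2') p1 ep hpy eyp.
have AL : 1 <= 4 * B ^+ 2 * (A * err xi p).
  have [h1|h1] := eqVneq (a' * p 0 0 + b' * p 0 1 + c' * p 0 2) 0; last first.
    apply: le_trans v1.
    by apply: norm_intr_ge1 h1; prove_int.
  have [h2|h2] := eqVneq (a' * p 0 1 + b' * p 0 2 + c' * p 0 3) 0; last first.
    apply: le_trans v2.
    by apply: norm_intr_ge1 h2; prove_int.
  by case/negP: ncop; apply: (annihilates_coplanar abc').
have : 1 ^+ 2 <= (4 * B ^+ 2 * (A * err xi p)) ^+ 2 by rewrite lerXn2r // nnegrE; lra.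
rewrite expr1n => h; apply: (le_trans h).
have -> : (4 * B ^+ 2 * (A * err xi p)) ^+ 2 = 16 * B ^+ 4 * (A ^+ 2 * err xi p ^+ 2) by ring.
by rewrite AA /M; have -> : 16 * B ^+ 4 * (2 * (2 * B ^+ 2 * H) * err xi p ^+ 2) =
  64 * B ^+ 6 * (H * err xi p ^+ 2) by ring.
Qed.
End Special.

(** * The sequence of minimal points *)

Section MinimalPoints.
Variables (R : realType) (xi : R).
Hypothesis hxi : extension_degree_gt xi 3.
Implicit Types (x y z w : 'rV[R]_4).

(** An error equal to zero would make [xi] rational. *)
Lemma err_gt0 x : integral_point x -> x != 0 -> 0 < err xi x.
Proof.
move=> ix x0; rewrite lt0r err_ge0 andbT; apply: contraNneq x0 => e0.
apply/eqP; apply: (integral_point0 (xi := xi)) => //; first by rewrite e0.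
have d1 : delta1 xi x = 0.
  by apply/eqP; rewrite -normr_le0 -e0 delta1_le.
have rel : x 0 1 + (- x 0 0) * xi + 0 * xi ^+ 2 + 0 * xi ^+ 3 = 0.
  by rewrite -[RHS]d1 /delta1; ring.
have ix0 : - x 0 0 \is a Num.int by rewrite rpredN.
have [_ h _ _] := no_integer_relation hxi (ix 1) ix0 (rpred0 _) (rpred0 _) rel.
by apply: oppr_inj; rewrite oppr0.
Qed.

(** The approximation hypothesis in terms of [err], for points with coordinates in
    the integers of R. *)
Definition uniform_points (D l X0 : R) : Prop := forall X, X0 <= X ->
  exists w, [/\ integral_point w, w != 0, height w <= X & err xi w <= D * X `^ (- l)].

Lemma uniform_pointsP (c l : R) : 0 < c -> uniformly_approximable xi c l ->
  exists2 X0 : R, 1 <= X0 & uniform_points ((1 + `|xi|) * c) l X0.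
Proof.
move=> c0 [M [_ hM]].
exists (Num.max 1 (M + 1)); first by rewrite le_max lexx.
move=> X; rewrite ge_max => /andP[X1 XM].
have [|x x0 [h0 h1 h2 h3]] := hM X; first by lra.
exists (\row_k (x 0 k)%:~R); split.
- by move=> k; rewrite mxE intr_int.
- apply: contraNneq x0 => /rowP h; apply/eqP/rowP => k.
  by have := h k; rewrite !mxE => /eqP; rewrite intr_eq0 => /eqP.
- by rewrite /height mxE.
- set e := c * X `^ (- l) in h1 h2 h3.
  have e0 : 0 <= e by rewrite mulr_ge0 ?powR_ge0 // ltW.
  rewrite -mulrA -/e.
  have xe : 0 <= `|xi| * e by exact: mulr_ge0.
  apply: err_leP.
  + rewrite /delta1 !mxE distrC mulrC; lra.
  + rewrite /delta2 !mxE.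
    have -> : (x 0 2)%:~R - xi * (x 0 1)%:~R =
      xi * ((x 0 0)%:~R * xi - (x 0 1)%:~R) - ((x 0 0)%:~R * xi ^+ 2 - (x 0 2)%:~R) :> R by ring.
    apply: (le_trans (ler_normB _ _)); rewrite normrM.
    by have := ler_wpM2l (normr_ge0 xi) h1; lra.
  + rewrite /delta3 !mxE.
    have -> : (x 0 3)%:~R - xi * (x 0 2)%:~R =
      xi * ((x 0 0)%:~R * xi ^+ 2 - (x 0 2)%:~R) - ((x 0 0)%:~R * xi ^+ 3 - (x 0 3)%:~R) :> R by ring.
    apply: (le_trans (ler_normB _ _)); rewrite normrM.
    by have := ler_wpM2l (normr_ge0 xi) h2; lra.
Qed.

Lemma uniform_points_small (D l X0 : R) : 0 <= D -> 0 < l -> 1 <= X0 ->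
  uniform_points D l X0 ->
  forall e, 0 < e -> exists w, [/\ integral_point w, w != 0 & err xi w < e].
Proof.
move=> D0 l0 X1 hU e e0.
set Y := Num.max (X0 `^ l) (D / e + 1).
have Y1 : D / e + 1 <= Y by rewrite le_max lexx orbT.
have Y0 : 0 < Y by apply: lt_le_trans Y1; rewrite ltr_wpDl // divr_ge0 // ltW.
have [|w [iw w0 _ ew]] := hU (Y `^ l^-1).
  have -> : X0 = (X0 `^ l) `^ l^-1.
    by rewrite -powRrM mulfV ?gt_eqF // powRr1 //; lra.
  apply: ge0_ler_powR; rewrite ?nnegrE ?powR_ge0 //.
  - by rewrite invr_ge0 ltW.
  - exact: ltW.
  - by rewrite le_max lexx.
exists w; split => //; apply: (le_lt_trans ew).
rewrite -powRrM mulrN mulVf ?gt_eqF // powR_inv1 ?ltW //.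
rewrite ltr_pdivrMr // mulrC -ltr_pdivrMr //; lra.
Qed.

(** The point after [x] in the sequence of minimal points has the least height among
    the points of smaller error. *)
Lemma next_point (x : 'rV[R]_4) :
  (forall e, 0 < e -> exists w, [/\ integral_point w, w != 0 & err xi w < e]) ->
  0 < err xi x ->
  exists y, [/\ integral_point y, y != 0, err xi y < err xi x &
    forall w, integral_point w -> w != 0 -> height w < height y ->
      err xi x <= err xi w].
Proof.
move=> small ex.
pose P n := `[< exists w, [/\ integral_point w, w != 0, err xi w < err xi x
   & height w = n%:R] >].
have hgt w : integral_point w -> exists n : nat, height w = n%:R.
  by move=> iw; apply/natrP; exact: natr_norm_int.
have exP : exists n, P n.
  have [w [iw w0 ew]] := small _ ex; have [n hn] := hgt _ iw.
  by exists n; apply/asboolP; exists w.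
case: (ex_minnP exP) => n /asboolP[y [iy y0 ey hy]] nmin.
exists y; split => // w iw w0 hw; rewrite leNgt; apply/negP => ew.
have [m hm] := hgt _ iw.
have /nmin : P m by apply/asboolP; exists w.
by move: hw; rewrite hm hy ltr_nat ltnNge => /negP.
Qed.

(** [ms_min] says that no point lower than the next minimal point improves on the
    error of the current one; [ms_unif] comes from the approximation
    hypothesis with X equal to half the height of the next point, which costs at most
    a factor 2 since the exponent is at most 1. *)
Record minimal_sequence (D l : R) (x : nat -> 'rV[R]_4) : Prop := MinimalSequence {
  ms_int : forall i, integral_point (x i);
  ms_err : forall i, err xi (x i.+1) < err xi (x i);
  ms_half : forall i, err xi (x i) < 1 / 2;
  ms_height : forall i, height (x i) < height (x i.+1);
  ms_min : forall i w, integral_point w -> w != 0 ->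
    height w < height (x i.+1) -> err xi (x i) <= err xi w;
  ms_unif : forall i, err xi (x i) <= 2 * D * height (x i.+1) `^ (- l);
  ms_lim : forall i, 1 + i%:R <= height (x i) }.

Lemma height_int_lt x y : integral_point x -> integral_point y ->
  height x < height y -> height x + 1 <= height y.
Proof.
move=> /(_ 0)/natr_norm_int/natrP[m hm] /(_ 0)/natr_norm_int/natrP[n hn].
by rewrite /height hm hn ltr_nat natr1 ler_nat.
Qed.

Lemma height_ge1 x : integral_point x -> x != 0 -> err xi x < 1 -> 1 <= height x.
Proof.
move=> ix x0 ex; apply: norm_intr_ge1 (ix 0) _.
by apply: contraNneq x0 => h; apply/eqP; exact: (integral_point0 (xi := xi)).
Qed.

(** The heights increase strictly: a point of the same height as its successor, both
    with error below 1/2, differs from it by a sign only. *)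
Lemma minimal_sequence_exists (D l X0 : R) : 0 < D -> 0 < l <= 1 -> 1 <= X0 ->
  uniform_points D l X0 -> exists s, minimal_sequence D l s.
Proof.
move=> D0 /andP[l0 l1] X1 hU.
have small := uniform_points_small (ltW D0) l0 X1 hU.
have hnext x : exists y, 0 < err xi x -> [/\ integral_point y, y != 0,
    err xi y < err xi x & forall w, integral_point w -> w != 0 ->
      height w < height y -> err xi x <= err xi w].
  have [h|h] := pselect (0 < err xi x); last by exists x.
  by have [y hy] := next_point small h; exists y.
have {hnext} [f hf] := choice hnext.
have [x0 [ix0 x0n ex0]] : exists w, [/\ integral_point w, w != 0 & err xi w < 1 / 2].
  by apply: small; lra.
pose s n := iter n f x0.
have good n : integral_point (s n) /\ s n != 0.
  elim: n => [|n [h1 h2]]; first by [].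
  by have [] := hf _ (err_gt0 h1 h2).
have pos n : 0 < err xi (s n) by case: (good n) => *; exact: err_gt0.
have edec n : err xi (s n.+1) < err xi (s n) by have [] := hf _ (pos n).
have emin n w : integral_point w -> w != 0 -> height w < height (s n.+1) ->
    err xi (s n) <= err xi w.
  by have [_ _ _ h] := hf _ (pos n); exact: h.
have ehalf n : err xi (s n) < 1 / 2.
  by elim: n => [//|n IH]; exact: lt_trans (edec n) IH.
have hinc n : height (s n.+1) < height (s n.+2).
  have [i1 n1] := good n.+1; have [i2 n2] := good n.+2.
  rewrite ltNge; apply/negP => hle.
  have [hlt|hge] := ltP (height (s n.+2)) (height (s n.+1)).
    by have := emin n _ i2 n2 hlt; have := edec n; have := edec n.+1; lra.
  have : `|s n.+2 0 0| = `|s n.+1 0 0| by apply/eqP; rewrite eq_le; apply/andP.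
  have e1 := ehalf n.+1; have e2 := ehalf n.+2.
  move/eqP; rewrite eqr_norm2 => /orP[] /eqP h.
    have : s n.+2 - s n.+1 = 0.
      apply: (integral_point0 (xi := xi)); first exact: integral_pointB.
        by apply: le_lt_trans (errB _ _ _) _; lra.
      by rewrite !mxE h subrr.
    by move/eqP; rewrite subr_eq0 => /eqP E; have := edec n.+1; rewrite E ltxx.
  have : s n.+2 + s n.+1 = 0.
    apply: (integral_point0 (xi := xi)); first exact: integral_pointD.
      by apply: le_lt_trans (errD _ _ _) _; lra.
    by rewrite !mxE h addNr.
  by move/eqP; rewrite addr_eq0 => /eqP E; have := edec n.+1; rewrite E errN ltxx.
have hlim n : 1 + n%:R <= height (s n.+1).
  elim: n => [|n IH].
    by rewrite addr0; apply: height_ge1; [case: (good 1)|case: (good 1)|have := ehalf 1; lra].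
  have [i1 _] := good n.+1; have [i2 _] := good n.+2.
  by have := height_int_lt i1 i2 (hinc n); rewrite -natr1; lra.
have [N hN] : exists N : nat, 2 * X0 <= N%:R.
  exists (Num.bound (2 * X0)); apply: ltW; apply: archi_boundP; lra.
(* The first point of [s] minimises nothing, and the approximation hypothesis only
   holds for heights that are large enough; both are dropped by the shift. *)
exists (fun n => s (n + N).+1); split.
- by move=> n; case: (good (n + N).+1).
- by move=> n; exact: edec.
- by move=> n; exact: ehalf.
- by move=> n; exact: hinc.
- by move=> n; exact: emin.
- move=> n; set h := height (s (n.+1 + N).+1).
  have hX : X0 <= h / 2.
    have := hlim (n.+1 + N)%N; rewrite -/h natrD => hh.
    have : 0 <= n.+1%:R :> R by exact: ler0n.
    by lra.
  have [w [iw w0 hw ew]] := hU _ hX.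
  have h0 : 0 < h by lra.
  apply: (@le_trans _ _ (err xi w)).
    by apply: emin => //; apply: le_lt_trans hw _; rewrite -/h; lra.
  apply: (le_trans ew); rewrite powRM ?invr_ge0 //; last exact: ltW.
  rewrite (_ : 2 * D * h `^ (- l) = D * (h `^ (- l) * 2)); last by ring.
  apply: ler_wpM2l; first exact: ltW.
  apply: ler_wpM2l; first exact: powR_ge0.
  rewrite -powR_inv1 // -powRrM mulN1r opprK.
  by rewrite -[leRHS](powRr1 (a := 2)) //; apply: ler_powR; lra.
- move=> n; apply: le_trans (hlim _); rewrite lerD2l ler_nat; exact: leq_addr.
Qed.
End MinimalPoints.

(** * Lattice bases of minimal points *)

Section MinimalPlanes.
Variables (R : realType) (xi D l : R) (x : nat -> 'rV[R]_4).
Hypothesis ms : minimal_sequence xi D l x.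
Implicit Types (w u v : 'rV[R]_4).

Lemma ms_height_ge1 i : 1 <= height (x i).
Proof. by have := ms_lim ms i; have := ler0n R i; lra. Qed.

(** Consecutive minimal points span a parallelogram whose area is comparable to the
    height of the second times the error of the first.  If the second is at least
    twice as high as the first, one term dominates.  Otherwise their difference, with
    the sign that makes it lower than the second point, has error at least that of
    the first by minimality; so one of the three forms takes values of opposite
    signs at the two points, after that choice of sign, and its two terms add up. *)
Lemma wedge_lower i : exists k : R, [\/ k = wedge1 xi (x i) (x i.+1),
    k = wedge2 xi (x i) (x i.+1) | k = wedge3 xi (x i) (x i.+1)] /\
  height (x i.+1) * err xi (x i) <= 2 * `|k|.
Proof.
set X := height (x i); set Y := height (x i.+1).
set e := err xi (x i).
have X1 : 1 <= X := ms_height_ge1 i.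
have XY : X < Y := ms_height ms i.
have ee : err xi (x i.+1) < e := ms_err ms i.
have e0 : 0 <= e by exact: err_ge0.
have [far|near] := leP (2 * X) Y.
  have key (d f : R) : e = `|d| -> `|f| <= err xi (x i.+1) ->
      Y * e <= 2 * `|x i 0 0 * f - x i.+1 0 0 * d|.
    move=> hd hf; have := lerB_normD (x i.+1 0 0 * d) (- (x i 0 0 * f)).
    rewrite -opprB !normrN !normrM -hd -/(height _) -/X -/(height (x i.+1)) -/Y.
    have : X * `|f| <= X * e by apply: ler_wpM2l; lra.
    have : 0 <= (Y - 2 * X) * e by apply: mulr_ge0; lra.
    by rewrite -[x i 0 0 * f - _]opprB normrN; lra.
  case: (err_attained xi (x i)) => h.
  - exists (wedge1 xi (x i) (x i.+1)); split; first by constructor 1.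
    exact: key h (delta1_le _ _).
  - exists (wedge2 xi (x i) (x i.+1)); split; first by constructor 2.
    exact: key h (delta2_le _ _).
  - exists (wedge3 xi (x i) (x i.+1)); split; first by constructor 3.
    exact: key h (delta3_le _ _).
have [s [s1 [t [t1 [hX hY]]]]] : exists s : R, (s = 1 \/ s = -1) /\ exists t : R,
   (t = 1 \/ t = -1) /\ (x i 0 0 = t * X /\ x i.+1 0 0 = s * t * Y).
  have sgn (a : R) : exists t : R, (t = 1 \/ t = -1) /\ a = t * `|a|.
    have [a0|a0] := leP 0 a; [exists 1|exists (-1)]; split; [by left| |by right|].
      by rewrite mul1r ger0_norm.
    by rewrite mulN1r ltr0_norm // opprK.
  have [t [ht tE]] := sgn (x i 0 0); have [r [hr rE]] := sgn (x i.+1 0 0).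
  exists (r * t); split.
    by case: ht => ->; case: hr => ->; rewrite ?mulN1r ?mul1r ?opprK; [left|right|right|left].
  exists t; split => //; split => //; rewrite {1}rE -/(height _) -/Y; congr (_ * Y).
  by case: ht => ->; ring.
pose w := x i.+1 - s *: x i.
have ints : s \is a Num.int by case: s1 => ->; rewrite ?rpredN rpred1.
have iw : integral_point w.
  apply: integral_pointB; first exact: ms_int ms _.
  by apply: integral_pointZ => //; exact: ms_int ms _.
have hw : height w = Y - X.
  rewrite /height !mxE hX hY (_ : s * t * Y - s * (t * X) = s * t * (Y - X)); last by ring.
  have -> : `|s * t * (Y - X)| = `|Y - X|.
    by rewrite !normrM; case: s1 => ->; case: t1 => ->; rewrite ?normrN normr1 !mul1r.
  by apply: ger0_norm; lra.
have w0 : w != 0.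
  by apply/eqP => w0; move: hw; rewrite w0 /height mxE normr0; lra.
have ew : e <= err xi w.
  by apply: (ms_min ms) => //; rewrite hw -/Y; lra.
have key (d f : R) : e <= `|f - s * d| -> `|f| <= err xi (x i.+1) ->
    Y * e <= 2 * `|x i 0 0 * f - x i.+1 0 0 * d|.
  rewrite hX hY => h hf.
  have -> : t * X * f - s * t * Y * d = t * (X * f - Y * (s * d)) by ring.
  rewrite normrM (_ : `|t| = 1) ?mul1r; last by case: t1 => ->; rewrite ?normrN normr1.
  move: (s * d) h => {}d h.
  apply: (@le_trans _ _ (2 * (X * e))).
    have : 0 <= (2 * X - Y) * e by apply: mulr_ge0; lra.
    by lra.
  apply: ler_wpM2l => //.
  have [f1 f2] : - e <= f /\ f <= e.
    by have : `|f| <= e; [lra|rewrite ler_norml => /andP[]].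
  have [fd|fd] := leP 0 (f - d).
    apply: le_trans (ler_norm _); rewrite ger0_norm // in h.
    have : 0 <= (Y - X) * (- d) by apply: mulr_ge0; lra.
    have : 0 <= X * (f - d - e) by apply: mulr_ge0; lra.
    by lra.
  rewrite -normrN; apply: le_trans (ler_norm _); rewrite ltr0_norm // in h.
  have : 0 <= (Y - X) * d by apply: mulr_ge0; lra.
  have : 0 <= X * (d - f - e) by apply: mulr_ge0; lra.
  by lra.
case: (err_attained xi w) => h; rewrite h in ew.
- exists (wedge1 xi (x i) (x i.+1)); split; first by constructor 1.
  apply: key (delta1_le _ _); apply: (le_trans ew).
  by rewrite (_ : _ - _ = delta1 xi w) // /w /delta1 !mxE; ring.
- exists (wedge2 xi (x i) (x i.+1)); split; first by constructor 2.
  apply: key (delta2_le _ _); apply: (le_trans ew).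
  by rewrite (_ : _ - _ = delta2 xi w) // /w /delta2 !mxE; ring.
- exists (wedge3 xi (x i) (x i.+1)); split; first by constructor 3.
  apply: key (delta3_le _ _); apply: (le_trans ew).
  by rewrite (_ : _ - _ = delta3 xi w) // /w /delta3 !mxE; ring.
Qed.

Lemma ms_indep i : ~~ parallel xi (x i) (x i.+1).
Proof.
apply/negP => /and3P[/eqP w1 /eqP w2 /eqP w3].
have [k [hk le_k]] := wedge_lower i.
have k0 : k = 0 by case: hk => ->.
have := ms_height_ge1 i.+1; have := ms_err ms i; have := err_ge0 xi (x i.+1).
move: le_k; rewrite k0 normr0 mulr0 => h1 h2 h3 h4.
have : 0 < height (x i.+1) * err xi (x i) by apply: mulr_gt0; lra.
by lra.
Qed.

Lemma round_half (a : R) : exists2 n : R, n \is a Num.int & `|a - n| <= 1 / 2.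
Proof.
exists (Num.floor (a + 1 / 2))%:~R; first exact: intr_int.
have := floor_itv (a + 1 / 2); rewrite intrD => /andP[h1 h2].
rewrite ler_norml; apply/andP; split; lra.
Qed.

(** Rounding the coefficients leaves an integral point with coefficients at most 1/2,
    lower than the second point and with smaller error than the first; by minimality
    it is zero. *)
Lemma lattice_basis i w s t : integral_point w -> w = s *: x i + t *: x i.+1 ->
  s \is a Num.int /\ t \is a Num.int.
Proof.
move=> iw wE; have [m im hm] := round_half s; have [n jn hn] := round_half t.
pose w' := w - (m *: x i + n *: x i.+1).
have iw' : integral_point w'.
  by apply: integral_pointB => //; apply: integral_pointD; apply: integral_pointZ => //;
    exact: ms_int ms _.
have w'E : w' = (s - m) *: x i + (t - n) *: x i.+1.
  by rewrite /w' wE !scalerBl opprD addrACA.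
have X1 := ms_height_ge1 i; have XY := ms_height ms i.
have e0 := err_ge0 xi (x i.+1); have ee := ms_err ms i.
have w'0 : w' = 0.
  apply/eqP; apply: contrapT => /negP w'n.
  have hw : height w' <= 1 / 2 * height (x i) + 1 / 2 * height (x i.+1).
    rewrite w'E; apply: (le_trans (heightD _ _)); rewrite !heightZ.
    by apply: lerD; apply: ler_wpM2r => //; exact: normr_ge0.
  have ew : err xi w' <= 1 / 2 * err xi (x i) + 1 / 2 * err xi (x i.+1).
    rewrite w'E; apply: (le_trans (errD _ _ _)); rewrite !errZ.
    by apply: lerD; apply: ler_wpM2r => //; exact: err_ge0.
  by have := ms_min ms (i := i) iw' w'n; lra.
have z0 : parallel xi (0 *: x i + 1 *: x i.+1) w' && parallel xi (1 *: x i + 0 *: x i.+1) w'.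
  by rewrite w'0 /parallel /wedge1 /wedge2 /wedge3 /delta1 /delta2 /delta3 !mxE
    !mulr0 !subrr !mul0r !mulr0 ?subrr !eqxx.
move: z0; rewrite w'E /parallel.
have [-> -> ->] := wedge_lin xi (x i) (x i.+1) 0 1 (s - m) (t - n).
have [-> -> ->] := wedge_lin xi (x i) (x i.+1) 1 0 (s - m) (t - n).
rewrite !mul0r !mul1r sub0r subr0 !mulf_eq0 oppr_eq0.
have := ms_indep i; rewrite /parallel !negb_and => npar /andP[h1 h2].
have sm : s - m == 0.
  by move: h1; case/or3P: npar => /negbTE ->; rewrite ?orbF => /and3P[].
have tn : t - n == 0.
  by move: h2; case/or3P: npar => /negbTE ->; rewrite ?orbF => /and3P[].
by move: sm tn; rewrite !subr_eq0 => /eqP -> /eqP ->.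
Qed.
End MinimalPlanes.

(** * Chains of independent triples *)

Section Chains.
Variables (R : realType) (xi : R).
Hypothesis hxi : extension_degree_gt xi 3.
Implicit Types (u v w : 'rV[R]_4).

Lemma infinite_enum (P : nat -> bool) : (forall N, exists2 i, (N <= i)%N & P i) ->
  exists f : nat -> nat, forall n, [/\ P (f n), (f n < f n.+1)%N &
    forall i, (f n < i < f n.+1)%N -> ~~ P i].
Proof.
move=> hP.
have ex N : exists i, (N <= i)%N && P i.
  by have [i h1 h2] := hP N; exists i; rewrite h1.
pose nxt N := ex_minn (ex N).
have nxtP N : [/\ (N <= nxt N)%N, P (nxt N) &
    forall i, (N <= i < nxt N)%N -> ~~ P i].
  rewrite /nxt; case: ex_minnP => m /andP[h1 h2] hm; split => // i /andP[i1 i2].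
  by apply/negP => Pi; have := hm i; rewrite i1 Pi leqNgt i2 => /(_ isT).
exists (fun n => iter n (fun k => nxt k.+1) (nxt 0%N)) => n /=.
set k := iter n _ _; have [h1 h2 h3] := nxtP k.+1; split => //.
by rewrite /k; case: n {k h1 h2 h3} => [|n] /=; [case: (nxtP 0%N)|case: (nxtP (iter n (fun k => nxt k.+1) (nxt 0%N)).+1)].
Qed.

Definition in_span u v w := exists s t : R, w = s *: u + t *: v.

Lemma in_span_trans u v a b w : in_span u v a -> in_span u v b -> in_span a b w ->
  in_span u v w.
Proof.
move=> [s1 [t1 ->]] [s2 [t2 ->]] [s [t ->]].
exists (s * s1 + t * s2), (s * t1 + t * t2).
by apply/rowP => k; rewrite !mxE; ring.
Qed.

Lemma in_spanl u v : in_span u v u.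
Proof. by exists 1, 0; rewrite scale1r scale0r addr0. Qed.
Lemma in_spanr u v : in_span u v v.
Proof. by exists 0, 1; rewrite scale1r scale0r add0r. Qed.

Lemma dot4_in_span a0 a1 a2 a3 u v w : in_span u v w ->
  dot4 a0 a1 a2 a3 u = 0 -> dot4 a0 a1 a2 a3 v = 0 -> dot4 a0 a1 a2 a3 w = 0.
Proof.
move=> [s [t ->]] hu hv.
transitivity (s * dot4 a0 a1 a2 a3 u + t * dot4 a0 a1 a2 a3 v).
  by rewrite /dot4 !mxE; ring.
by rewrite hu hv !mulr0 addr0.
Qed.

(** The points converge in direction to (1, xi, xi^2, xi^3), so an integral linear form
    that kills them all would be a relation between the powers of [xi]. *)
Lemma not_in_hyperplane (x : nat -> 'rV[R]_4) (a0 a1 a2 a3 : R) :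
  (forall i, err xi (x i) <= 1) -> (forall M, exists i, M <= height (x i)) ->
  a0 \is a Num.int -> a1 \is a Num.int -> a2 \is a Num.int -> a3 \is a Num.int ->
  (forall i, dot4 a0 a1 a2 a3 (x i) = 0) -> a0 = 0 /\ a1 = 0 /\ a2 = 0 /\ a3 = 0.
Proof.
move=> ex hx i0 i1 i2 i3 hd.
set L := a0 + a1 * xi + a2 * xi ^+ 2 + a3 * xi ^+ 3.
suff L0 : L = 0 by have [-> -> -> ->] := no_integer_relation hxi i0 i1 i2 i3 L0.
pose C := `|a1| + `|a2 * xi| + `|a2| + `|a3 * xi ^+ 2| + `|a3 * xi| + `|a3|.
have bnd i : `|L| * height (x i) <= C.
  rewrite -normrM -normrN.
  have -> : - (L * x i 0 0) = a1 * delta1 xi (x i) + a2 * xi * delta1 xi (x i)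
     + a2 * delta2 xi (x i) + a3 * xi ^+ 2 * delta1 xi (x i)
     + a3 * xi * delta2 xi (x i) + a3 * delta3 xi (x i) - dot4 a0 a1 a2 a3 (x i).
    by rewrite /L /dot4 /delta1 /delta2 /delta3; ring.
  have le1 (a d : R) : `|d| <= err xi (x i) -> `|a * d| <= `|a|.
    by move=> h; rewrite normrM ler_piMr // (le_trans h).
  rewrite hd subr0 /C.
  by do 5!(apply: (le_trans (ler_normD _ _)); apply: lerD; last by
    apply: le1; rewrite ?delta1_le ?delta2_le ?delta3_le);
    apply: le1; exact: delta1_le.
apply/eqP; apply: contrapT => /negP L0.
have Lp : 0 < `|L| by rewrite normr_gt0.
have [i hi] := hx (C / `|L| + 1).
have := bnd i; rewrite -ler_pdivlMl // mulrC => h.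
by lra.
Qed.

(** If all later triples were coplanar, all later points would stay in the plane of
    two of them, and integral linear forms vanish on that plane. *)
Lemma ms_noncoplanar (D l : R) (x : nat -> 'rV[R]_4) : minimal_sequence xi D l x ->
  forall N, exists2 i, (N <= i)%N & ~~ coplanar (x i) (x i.+1) (x i.+2).
Proof.
move=> ms N; apply: contrapT => hno.
have cop i : (N <= i)%N -> coplanar (x i) (x i.+1) (x i.+2).
  by move=> Ni; apply: contrapT => /negP h; apply: hno; exists i.
have span i : in_span (x N) (x N.+1) (x (i + N)%N) /\
    in_span (x N) (x N.+1) (x (i + N).+1).
  elim: i => [|i [h1 h2]]; first by split; [exact: in_spanl|exact: in_spanr].
  split => //; apply: in_span_trans h1 h2 _.
  by apply: (coplanar_span (ms_indep ms _)); apply: cop; exact: leq_addl.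
have ix := ms_int ms.
have key a0 a1 a2 a3 : a0 \is a Num.int -> a1 \is a Num.int ->
   a2 \is a Num.int -> a3 \is a Num.int ->
   dot4 a0 a1 a2 a3 (x N) = 0 -> dot4 a0 a1 a2 a3 (x N.+1) = 0 ->
   a0 = 0 /\ a1 = 0 /\ a2 = 0 /\ a3 = 0.
  move=> i0 i1 i2 i3 h1 h2.
  apply: (@not_in_hyperplane (fun i => x (i + N)%N)) => //.
  - by move=> i; have := ms_half ms (i + N); lra.
  - move=> M; have [m hm] : exists m : nat, `|M| <= m%:R.
      by exists (Num.bound `|M|); apply: ltW; exact: archi_boundP.
    exists m; have := ms_lim ms (m + N); rewrite natrD.
    by have := ler_norm M; have := ler0n R N; lra.
  - by move=> i; exact: dot4_in_span (span i).1 h1 h2.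
set u := x N; set v := x N.+1.
have iu k : u 0 k \is a Num.int by exact: ix.
have iv k : v 0 k \is a Num.int by exact: ix.
have im (i j : 'I_4) : u 0 i * v 0 j - u 0 j * v 0 i \is a Num.int.
  by rewrite rpredB // rpredM.
(* Three integral vectors orthogonal to both points; together they show that the
   minors containing the first coordinate vanish. *)
have [_ [_ [m01 _]]] : u 0 1 * v 0 2 - u 0 2 * v 0 1 = 0 /\
   u 0 2 * v 0 0 - u 0 0 * v 0 2 = 0 /\ u 0 0 * v 0 1 - u 0 1 * v 0 0 = 0 /\ 0 = 0 :> R.
  by apply: key; rewrite ?rpred0 //; rewrite /dot4 -/u -/v; ring.
have [_ [m03 [_ _]]] : u 0 1 * v 0 3 - u 0 3 * v 0 1 = 0 /\
   u 0 3 * v 0 0 - u 0 0 * v 0 3 = 0 /\ 0 = 0 :> R /\ u 0 0 * v 0 1 - u 0 1 * v 0 0 = 0.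
  by apply: key; rewrite ?rpred0 //; rewrite /dot4 -/u -/v; ring.
have [_ [_ [_ m02]]] : u 0 2 * v 0 3 - u 0 3 * v 0 2 = 0 /\
   0 = 0 :> R /\ u 0 3 * v 0 0 - u 0 0 * v 0 3 = 0 /\ u 0 0 * v 0 2 - u 0 2 * v 0 0 = 0.
  by apply: key; rewrite ?rpred0 //; rewrite /dot4 -/u -/v; ring.
have := ms_indep ms N; rewrite -/u -/v => /negP; apply.
rewrite /parallel /wedge1 /wedge2 /wedge3 /delta1 /delta2 /delta3.
apply/and3P; split; apply/eqP.
- by rewrite -[RHS]m01; ring.
- by transitivity ((u 0 0 * v 0 2 - u 0 2 * v 0 0) -
      xi * (u 0 0 * v 0 1 - u 0 1 * v 0 0)); [ring|rewrite m01 m02; ring].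
- by transitivity (- (u 0 3 * v 0 0 - u 0 0 * v 0 3) -
      xi * (u 0 0 * v 0 2 - u 0 2 * v 0 0)); [ring|rewrite m03 m02; ring].
Qed.

(** The independent triples of consecutive minimal points.  Between two of them the
    minimal points stay in one plane, which is recorded by [ch_next], [ch_spanP],
    [ch_spanY] and [ch_spanZ]. *)
Record chain (D l : R) (p y z : nat -> 'rV[R]_4) : Prop := Chain {
  ch_intP : forall n, integral_point (p n);
  ch_intY : forall n, integral_point (y n);
  ch_intZ : forall n, integral_point (z n);
  ch_indep : forall n, ~~ coplanar (p n) (y n) (z n);
  ch_parPY : forall n, ~~ parallel xi (p n) (y n);
  ch_parYZ : forall n, ~~ parallel xi (y n) (z n);
  ch_heightP : forall n, 1 <= height (p n);
  ch_heightY : forall n, height (p n) < height (y n);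
  ch_heightZ : forall n, height (y n) < height (z n);
  ch_heightS : forall n, height (z n) <= height (y n.+1);
  ch_errP : forall n, err xi (p n) < 1 / 2;
  ch_errY : forall n, err xi (y n) < err xi (p n);
  ch_errZ : forall n, err xi (z n) < err xi (y n);
  ch_errS : forall n, err xi (y n.+1) <= err xi (z n);
  ch_unifP : forall n, err xi (p n) <= 2 * D * height (y n) `^ (- l);
  ch_unifY : forall n, err xi (y n) <= 2 * D * height (z n) `^ (- l);
  ch_lim : forall n, n%:R <= height (p n);
  ch_next : forall n, exists s t : R, [/\ s \is a Num.int, t \is a Num.int &
    y n.+1 = s *: y n + t *: z n];
  ch_spanP : forall n, in_span (y n) (z n) (p n.+1);
  ch_spanY : forall n, in_span (p n.+1) (y n.+1) (y n);
  ch_spanZ : forall n, in_span (p n.+1) (y n.+1) (z n);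
  ch_area : forall n, height (y n.+1) * err xi (p n.+1) <=
    4 * (height (z n) * err xi (y n)) }.

Lemma ms_height_mono (D l : R) (x : nat -> 'rV[R]_4) : minimal_sequence xi D l x ->
  forall i j, (i <= j)%N -> height (x i) <= height (x j) /\ err xi (x j) <= err xi (x i).
Proof.
move=> ms i j /subnK <-; elim: (j - i)%N => [|k [h1 h2]]; first by rewrite add0n.
by split; [apply: le_trans h1 _|apply: le_trans _ h2]; rewrite ltW //;
  [exact: ms_height ms _|exact: ms_err ms _].
Qed.

(** Between consecutive independent triples each minimal point is a combination of the
    two preceding ones, so the plane does not change.  The area inequality compares the
    basis (p_(n+1), y_(n+1)) of the integral points of that plane with (y_n, z_n). *)
Lemma chain_exists (D l : R) (x : nat -> 'rV[R]_4) : minimal_sequence xi D l x ->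
  exists p y z, chain D l p y z.
Proof.
move=> ms; have [f hf] := infinite_enum (ms_noncoplanar ms).
have mono := ms_height_mono ms.
have flt n : (f n < f n.+1)%N by case: (hf n).
have fge n : (n <= f n)%N by elim: n => // n IH; exact: leq_ltn_trans IH (flt n).
pose Q n k := [/\ in_span (x (f n).+1) (x (f n).+2) (x k),
   in_span (x (f n).+1) (x (f n).+2) (x k.+1),
   in_span (x k) (x k.+1) (x (f n).+1) & in_span (x k) (x k.+1) (x (f n).+2)].
have plane n k : (f n + k < f n.+1)%N -> Q n (f n + k).+1.
  elim: k => [_|k IH hk].
    by rewrite addn0; split; [exact: in_spanl|exact: in_spanr|exact: in_spanl|exact: in_spanr].
  have [|q1 q2 q3 q4] := IH; first by apply: ltn_trans hk; rewrite addnS.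
  rewrite addnS; set m := (f n + k).+1 in q1 q2 q3 q4 *.
  have cop : coplanar (x m) (x m.+1) (x m.+2).
    have [_ _ h] := hf n.
    have : (f n < m < f n.+1)%N by rewrite /m ltnS leq_addr -addnS.
    by move/h; rewrite negbK.
  have [s [t E]] := coplanar_span (ms_indep ms m) cop.
  have s0 : s != 0.
    apply: contra (ms_indep ms m.+1) => /eqP s0.
    rewrite E s0 scale0r add0r /parallel /wedge1 /wedge2 /wedge3 /delta1 /delta2 /delta3 !mxE.
    by apply/and3P; split; apply/eqP; ring.
  have xm : in_span (x m.+1) (x m.+2) (x m).
    exists (- (s^-1 * t)), s^-1; rewrite E; apply/rowP => i; rewrite !mxE.
    by rewrite mulrDr !mulrA mulVf //; ring.
  split => //.
  - by apply: in_span_trans q1 q2 _; exists s, t.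
  - by apply: in_span_trans q3; [|exact: in_spanl].
  - by apply: in_span_trans q4; [|exact: in_spanl].
have {plane} plane n : Q n (f n.+1).
  have := plane n (f n.+1 - (f n).+1)%N; rewrite -addSn subnKC //.
  by apply; exact: ltnSn.
exists (fun n => x (f n)), (fun n => x (f n).+1), (fun n => x (f n).+2).
split.
- by move=> n; exact: ms_int ms _.
- by move=> n; exact: ms_int ms _.
- by move=> n; exact: ms_int ms _.
- by move=> n; case: (hf n).
- by move=> n; exact: ms_indep ms _.
- by move=> n; exact: ms_indep ms _.
- by move=> n; exact: ms_height_ge1 ms _.
- by move=> n; exact: ms_height ms _.
- by move=> n; exact: ms_height ms _.
- by move=> n; case: (mono (f n).+2 (f n.+1).+1); rewrite ?ltnS.
- by move=> n; exact: ms_half ms _.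
- by move=> n; exact: ms_err ms _.
- by move=> n; exact: ms_err ms _.
- by move=> n; case: (mono (f n).+2 (f n.+1).+1); rewrite ?ltnS.
- by move=> n; exact: ms_unif ms _.
- by move=> n; exact: ms_unif ms _.
- move=> n; have := ms_lim ms (f n); have : n%:R <= (f n)%:R :> R by rewrite ler_nat.
  by lra.
- move=> n; have [_ [s [t E]] _ _] := plane n; exists s, t.
  by have [] := lattice_basis ms (ms_int ms _) E.
- by move=> n; case: (plane n).
- by move=> n; case: (plane n).
- by move=> n; case: (plane n).
- move=> n; have [_ _ [s [t Ey]] [s' [t' Ez]]] := plane n.
  have [si ti] := lattice_basis ms (ms_int ms _) Ey.
  have [si' ti'] := lattice_basis ms (ms_int ms _) Ez.
  set m := s * t' - t * s'.
  have im : m \is a Num.int by rewrite /m rpredB // rpredM.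
  have := wedge_lin xi (x (f n.+1)) (x (f n.+1).+1) s t s' t'.
  rewrite /= -Ey -Ez -/m => -[w1 w2 w3].
  have m0 : m != 0.
    apply: contra (ms_indep ms (f n).+1) => /eqP m0.
    by rewrite /parallel w1 w2 w3 m0 !mul0r eqxx.
  have m1 : 1 <= `|m| by exact: norm_intr_ge1.
  have [b1 b2 b3] := wedge_le (ltW (ms_height ms (f n).+1)) (ltW (ms_err ms (f n).+1)).
  have [k [hk le_k]] := wedge_lower ms (f n.+1).
  apply: (le_trans le_k).
  rewrite (_ : 4 * _ = 2 * (2 * (height (x (f n).+2) * err xi (x (f n).+1)))); last by ring.
  apply: ler_wpM2l => //.
  apply: (@le_trans _ _ `|m * k|); first by rewrite normrM ler_peMl.
  by case: hk => ->; rewrite -?w1 -?w2 -?w3.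
Qed.
End Chains.

(** * Nonvanishing of the cubic covariant *)

Section ChainEstimates.
Variables (R : realType) (xi : R).
Hypothesis hxi : extension_degree_gt xi 3.
Variables (D l t : R) (p y z : nat -> 'rV[R]_4).
Hypothesis ch : chain xi D l p y z.
Hypothesis D01 : 0 < 2 * D <= 1.
Hypothesis lt1 : (1 + t) * l = 1.
Hypothesis t_range : 1 < t < 19 / 14.

Let B := 1 + `|xi|.
Let a n := ln (height (y n)).
Let b n := ln (height (z n)).
Let r n := ln (err xi (p n)).
Let s n := ln (err xi (y n)).

Implicit Types u v w : 'rV[R]_4.

Lemma B_ge1 : 1 <= B. Proof. by rewrite /B lerDl. Qed.
Lemma B_gt0 : 0 < B. Proof. exact: lt_le_trans ltr01 B_ge1. Qed.

Lemma ch_height_pos n : [/\ 0 < height (p n), 0 < height (y n) & 0 < height (z n)].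
Proof.
by have := ch_heightP ch n; have := ch_heightY ch n; have := ch_heightZ ch n;
  split; lra.
Qed.

Lemma ch_err_pos n : 0 < err xi (p n) /\ 0 < err xi (y n).
Proof.
have [h1 h2 _] := ch_height_pos n.
have nz (w : 'rV[R]_4) : 0 < height w -> w != 0.
  by move=> h; apply: contraTneq h => ->; rewrite /height mxE normr0 ltxx.
by split; apply: err_gt0 hxi _ _ _; rewrite ?nz //; [exact: ch_intP ch n|exact: ch_intY ch n].
Qed.

Lemma ch_order n : b n <= a n.+1 /\ a n <= b n.
Proof.
have [_ h1 h2] := ch_height_pos n; have [_ h3 _] := ch_height_pos n.+1.
by split; rewrite /a /b ler_ln ?posrE //; [exact: ch_heightS ch n|exact: ltW (ch_heightZ ch n)].
Qed.

Lemma ch_b_ge0 n : 0 <= b n.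
Proof.
rewrite /b ln_ge0 //.
by have := ch_heightP ch n; have := ch_heightY ch n; have := ch_heightZ ch n; lra.
Qed.

Lemma ch_b_lim M : exists N, forall n, (N <= n)%N -> M <= b n.
Proof.
have e0 := expR_gt0 M.
exists (Num.bound (expR M)) => n hn.
rewrite -[M]expRK /b ler_ln ?posrE //; last by have [] := ch_height_pos n.
have h1 : expR M < (Num.bound (expR M))%:R by apply: archi_boundP; exact: ltW.
have h2 : (Num.bound (expR M))%:R <= n%:R :> R by rewrite ler_nat.
by have := ch_lim ch n; have := ch_heightY ch n; have := ch_heightZ ch n; lra.
Qed.

Lemma ln_powR_bound (e h : R) : 0 < e -> 0 < h -> e <= 2 * D * h `^ (- l) ->
  (1 + t) * ln e <= (1 + t) * ln (2 * D) - ln h.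
Proof.
move=> e0 h0 he; have /andP[D0 _] := D01; have /andP[t1 _] := t_range.
have hl : ln e <= ln (2 * D) - l * ln h.
  rewrite -mulNr -ln_powR -lnM ?posrE ?powR_gt0 //.
  by rewrite ler_ln ?posrE // mulr_gt0 // powR_gt0.
have : 0 <= (1 + t) * (ln (2 * D) - l * ln h - ln e) by apply: mulr_ge0; lra.
have : (1 + t) * (l * ln h) = ln h by rewrite mulrA lt1 mul1r.
by lra.
Qed.

Lemma ch_s_le n : (1 + t) * s n <= (1 + t) * ln (2 * D) - b n.
Proof.
have [_ _ h] := ch_height_pos n; have [_ e0] := ch_err_pos n.
by apply: ln_powR_bound => //; exact: ch_unifY ch n.
Qed.

Lemma ch_r_le n : (1 + t) * r n <= (1 + t) * ln (2 * D) - a n.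
Proof.
have [_ h _] := ch_height_pos n; have [e0 _] := ch_err_pos n.
by apply: ln_powR_bound => //; exact: ch_unifP ch n.
Qed.

Lemma lnD_le0 : (1 + t) * ln (2 * D) <= 0.
Proof.
have /andP[t1 _] := t_range; have /andP[_ D1] := D01.
by apply: mulr_ge0_le0; [lra|exact: ln_le0].
Qed.

Lemma ch_area_ln n : a n.+1 + r n.+1 <= ln 4 + b n + s n.
Proof.
have [_ h1 h2] := ch_height_pos n; have [_ h3 _] := ch_height_pos n.+1.
have [_ e1] := ch_err_pos n; have [e2 _] := ch_err_pos n.+1.
rewrite /a /b /r /s -!lnM ?posrE ?mulr_gt0 // ler_ln ?posrE ?mulr_gt0 //.
by have := ch_area ch n; rewrite mulrA.
Qed.

Lemma ch_small n : [/\ err xi (p n) <= 1, err xi (y n) <= 1 & err xi (z n) <= 1].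
Proof.
by have := ch_errP ch n; have := ch_errY ch n; have := ch_errZ ch n; split; lra.
Qed.

Lemma cov_int u v : integral_point u -> integral_point v ->
  cov_lo u v \is a Num.int /\ cov_hi u v \is a Num.int.
Proof.
move=> iu iv; rewrite /cov_lo /cov_hi /hankel_a /hankel_b /hankel_c.
by split; prove_int.
Qed.

(** By [rank_one_bound] a point y_n of rank one satisfies
    1 << height(y_n) err(p_n)^3, which fails for large heights since [l] exceeds 1/3. *)
Lemma ch_rank2 : exists N, forall n, (N <= n)%N ->
  ~ (hankel_b (y n) = 0 /\ hankel_c (y n) = 0).
Proof.
have /andP[t1 t2] := t_range.
set K := ln (8 * B ^+ 6).
have B0 := B_gt0.
have [N hN] := ch_b_lim ((1 + t) * K / (2 - t) + 1).
exists N.+1 => -[|n] // hn [hb hc].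
have [p0 y0 z0] := ch_height_pos n.+1; have [ep0 ey0] := ch_err_pos n.+1.
have [ep1 ey1 _] := ch_small n.+1.
have par : ~~ parallel xi (y n.+1) (p n.+1).
  by rewrite parallel_sym; exact: ch_parPY ch n.+1.
have := rank_one_bound (ch_intY ch n.+1) (ch_intP ch n.+1) hb hc par
  (ch_heightP ch n.+1) (ltW (ch_heightY ch n.+1)) ep1 (ltW (ch_errY ch n.+1)).
rewrite -/B => h; have : 0 <= ln (8 * B ^+ 6 * (height (y n.+1) * err xi (p n.+1) ^+ 3)).
  by rewrite ln_ge0.
rewrite lnM ?posrE ?mulr_gt0 ?exprn_gt0 // lnM ?posrE ?exprn_gt0 // lnXn // -/K -/(a _) -/(r _) => h0.
have h1 := ch_r_le n.+1; have h2 := lnD_le0; have [h3 _] := ch_order n.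
have h4 : (1 + t) * K / (2 - t) + 1 <= b n by exact: hN.
have h5 : 0 <= (1 + t) * (K + (a n.+1 + r n.+1 *+ 3)) by apply: mulr_ge0; lra.
have h6 : 0 <= (2 - t) * (b n - ((1 + t) * K / (2 - t) + 1)) by apply: mulr_ge0; lra.
have h7 : (2 - t) * ((1 + t) * K / (2 - t) + 1) = (1 + t) * K + (2 - t).
  by field; apply: lt0r_neq0; lra.
have h8 : 0 <= (2 - t) * (a n.+1 - b n) by apply: mulr_ge0; lra.
by lra.
Qed.

Lemma hankel_annihilates u : annihilates (hankel_a u) (hankel_b u) (hankel_c u) u.
Proof. by rewrite /annihilates /hankel_a /hankel_b /hankel_c; split; ring. Qed.

Lemma cov_pos u v : integral_point u -> integral_point v ->
  ~ (cov_lo u v = 0 /\ cov_hi u v = 0) ->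
  1 <= `|cov_lo u v| \/ 1 <= `|cov_hi u v|.
Proof.
move=> iu iv h; have [i1 i2] := cov_int iu iv.
have [h1|h1] := eqVneq (cov_lo u v) 0; last by left; exact: norm_intr_ge1.
have [h2|h2] := eqVneq (cov_hi u v) 0; last by right; exact: norm_intr_ge1.
by case: h.
Qed.

(** A nonzero integer among the components of C(y_n, p_n), bounded by [cov_le]. *)
Lemma cov_back_bound n : ~ (cov_lo (y n) (p n) = 0 /\ cov_hi (y n) (p n) = 0) ->
  0 <= ln (8 * B ^+ 2) + a n + s n + r n.
Proof.
move=> h; have [p0 y0 z0] := ch_height_pos n; have [ep0 ey0] := ch_err_pos n.
have [ep1 ey1 _] := ch_small n.
have p1 := ch_heightP ch n; have py := ch_heightY ch n; have eyp := ch_errY ch n.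
have y1 : 1 <= height (y n) by lra.
have [b1 b2 _] := cov_le ey1 ep1 y1 p1.
have B0 := B_gt0.
have bE : 4 * (1 + `|xi|) ^+ 2 * (height (y n) * err xi (y n) * err xi (p n) +
   height (p n) * err xi (y n) ^+ 2) <=
   8 * B ^+ 2 * (height (y n) * err xi (y n) * err xi (p n)).
  rewrite -/B (_ : 8 * B ^+ 2 * _ = 4 * B ^+ 2 * (height (y n) * err xi (y n) * err xi (p n)
    + height (y n) * err xi (y n) * err xi (p n))); last by ring.
  apply: ler_wpM2l; first by rewrite mulr_ge0 ?exprn_ge0 // (le_trans ler01 B_ge1).
  rewrite lerD2l expr2 mulrA; apply: ler_pM.
  - by apply: mulr_ge0; exact: ltW.
  - exact: ltW.
  - by apply: ler_wpM2r; exact: ltW.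
  - exact: ltW.
have one : 1 <= 8 * B ^+ 2 * (height (y n) * err xi (y n) * err xi (p n)).
  by case: (cov_pos (ch_intY ch n) (ch_intP ch n) h) => h1; apply: (le_trans h1);
   [apply: (le_trans b1)|apply: (le_trans b2)].
have : 0 <= ln (8 * B ^+ 2 * (height (y n) * err xi (y n) * err xi (p n))) by rewrite ln_ge0.
by rewrite !lnM ?posrE ?mulr_gt0 // -/(a n) -/(s n) -/(r n) !addrA.
Qed.

(** Suppose that the plane of (y_n, z_n) is annihilated by a recurrence.  That
    recurrence is the one of y_n, so it does not annihilate p_n, and both
    [special_bound] and [cov_back_bound] apply.  Together they give
    2 b_(n-1) <= t^2 b_(n-1) + O(1) for the logarithms b of the heights of the z's,
    and t^2 < 2. *)
Lemma ch_nonspecial : exists N, forall n, (N <= n)%N ->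
  ~ (hankel_b (y n) = 0 /\ hankel_c (y n) = 0) /\
  ~ (cov_lo (y n) (z n) = 0 /\ cov_hi (y n) (z n) = 0).
Proof.
have /andP[t1 t2] := t_range.
have tt : t ^+ 2 < 15 / 8 by nra.
have [N1 hN1] := ch_rank2.
set K1 := ln (64 * B ^+ 6); set K2 := ln (8 * B ^+ 2).
have B0 := B_gt0.
set M := (1 + t) * K1 + t * ((1 + t) * (K2 + ln 4)).
have [N2 hN2] := ch_b_lim (8 * (`|M| + 1)).
exists (maxn N1 N2.+1) => n; rewrite geq_max => /andP[n1 n2].
split; first exact: hN1.
case: n n1 n2 => // n n1; rewrite ltnS => n2 special.
have rk := hN1 _ n1.
have abc : ~ (hankel_a (y n.+1) = 0 /\ hankel_b (y n.+1) = 0 /\ hankel_c (y n.+1) = 0).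
  by move=> [_ h]; exact: rk.
have iy := ch_intY ch n.+1; have ip := ch_intP ch n.+1; have iz := ch_intZ ch n.+1.
have [ep1 ey1 ez1] := ch_small n.+1.
have [ia [ib ic]] : hankel_a (y n.+1) \is a Num.int /\ hankel_b (y n.+1) \is a Num.int
    /\ hankel_c (y n.+1) \is a Num.int.
  by rewrite /hankel_a /hankel_b /hankel_c; do !split; prove_int.
have := special_bound ia ib ic abc ip iy iz (hankel_annihilates _) special
  (ch_parYZ ch _) (ch_indep ch _) (ch_heightP ch _) (ltW (ch_heightY ch _))
  (ltW (ch_heightZ ch _)) (ltW (ch_errZ ch _)) (ltW (ch_errY ch _)) ep1.
have [p0 y0 z0] := ch_height_pos n.+1; have [ep0 ey0] := ch_err_pos n.+1.
rewrite -/B => h; have {h} : 0 <= ln (64 * B ^+ 6 *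
   (height (z n.+1) * err xi (y n.+1) * err xi (p n.+1) ^+ 2)) by rewrite ln_ge0.
rewrite lnM ?posrE ?mulr_gt0 ?exprn_gt0 // -/K1.
rewrite lnM ?posrE ?mulr_gt0 ?exprn_gt0 // lnM ?posrE //.
rewrite lnXn // -/(b _) -/(s _) -/(r _) mulr2n => h1.
have nback : ~ (cov_lo (y n.+1) (p n.+1) = 0 /\ cov_hi (y n.+1) (p n.+1) = 0).
  move=> hp; have := ch_indep ch n.+1.
  by rewrite (annihilates_coplanar abc hp (hankel_annihilates _) special).
have := cov_back_bound nback; rewrite -/K2 => h2.
have h3 := ch_area_ln n; have h4 := ch_s_le n; have h5 := ch_s_le n.+1.
have h6 := ch_r_le n.+1; have h7 := lnD_le0; have [h8 _] := ch_order n.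
have h9 := hN2 _ n2.
have e1 : 0 <= (1 + t) * (K1 + (b n.+1 + s n.+1 + (r n.+1 + r n.+1))).
  by apply: mulr_ge0; lra.
have e2 : 0 <= t * ((1 + t) * (K2 + ln 4 + b n + s n + s n.+1)).
  by apply: mulr_ge0; [lra|apply: mulr_ge0; lra].
have e3 : 0 <= t * (- b n.+1 - (1 + t) * s n.+1) by apply: mulr_ge0; lra.
have e4 : 0 <= t * (- b n - (1 + t) * s n) by apply: mulr_ge0; lra.
have e5 : M <= `|M| by exact: ler_norm.
have e6 : 0 <= (15 / 8 - t ^+ 2) * b n by apply: mulr_ge0; [lra|exact: ch_b_ge0].
by rewrite /M in e5 h9; lra.
Qed.
End ChainEstimates.

(** * The exponent and its quartic equation *)

(** Clearing the two square roots, one after the other. *)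
Lemma lambda3_quartic (R : realType) :
  let l := lambda3 R in l ^+ 4 - 4 * l ^+ 3 + 3 * l - 1 = 0.
Proof.
rewrite /lambda3 /=; set s := Num.sqrt 5; set q := Num.sqrt (7 + 2 * s).
have hs : s ^+ 2 = 5 by rewrite sqr_sqrtr.
have s0 : 0 <= s by exact: sqrtr_ge0.
have hq : q ^+ 2 = 7 + 2 * s by rewrite sqr_sqrtr //; lra.
have hl : 2 * ((2 + s - q) / 2) ^+ 2 - 4 * ((2 + s - q) / 2) + 1
          = s * (2 * ((2 + s - q) / 2) - 1).
  have -> : 2 * ((2 + s - q) / 2) ^+ 2 - 4 * ((2 + s - q) / 2) + 1 =
    (s ^+ 2 + q ^+ 2 - 2 * s * q - 2) / 2 by field.
  have -> : s * (2 * ((2 + s - q) / 2) - 1) =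
    (s ^+ 2 + s - s * q) by field.
  by rewrite hq hs; field.
set l := (2 + s - q) / 2 in hl *.
have : (2 * l ^+ 2 - 4 * l + 1) ^+ 2 = 5 * (2 * l - 1) ^+ 2.
  by rewrite hl exprMn hs.
move=> h; have -> : l ^+ 4 - 4 * l ^+ 3 + 3 * l - 1 =
  ((2 * l ^+ 2 - 4 * l + 1) ^+ 2 - 5 * (2 * l - 1) ^+ 2) / 4 by field.
by rewrite h subrr mul0r.
Qed.

Lemma lambda3_bounds (R : realType) : 14 / 33 < lambda3 R < 1 / 2.
Proof.
rewrite /lambda3 /=; set s := Num.sqrt 5; set q := Num.sqrt (7 + 2 * s).
have hs : s ^+ 2 = 5 by rewrite sqr_sqrtr.
have s0 : 0 <= s by exact: sqrtr_ge0.
have hq : q ^+ 2 = 7 + 2 * s by rewrite sqr_sqrtr //; lra.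
have q0 : 0 <= q by exact: sqrtr_ge0.
have s1 : 38 / 17 < s by nra.
have q1 : s + 1 < q by nra.
have q2 : q < s + 38 / 33 by nra.
by apply/andP; split; lra.
Qed.

Definition ratio3 (R : realType) : R := (1 - lambda3 R) / lambda3 R.

Lemma lambda3_ratio3 (R : realType) : (1 + ratio3 R) * lambda3 R = 1.
Proof.
have /andP[h1 h2] := lambda3_bounds R.
by rewrite /ratio3; field; apply: lt0r_neq0; lra.
Qed.

Lemma ratio3_bounds (R : realType) : 1 < ratio3 R < 19 / 14.
Proof.
have /andP[h1 h2] := lambda3_bounds R.
have l0 : 0 < lambda3 R by lra.
by rewrite /ratio3 ltr_pdivlMr // ltr_pdivrMr //; apply/andP; split; lra.
Qed.

Lemma ratio3_quartic (R : realType) : let t := ratio3 R in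
  (t ^+ 2 - 1) ^+ 2 = t + t ^+ 2 - t ^+ 3.
Proof.
move=> t; have /andP[h1 h2] := ratio3_bounds R.
have t1 : 1 + t != 0 by apply: lt0r_neq0; rewrite /t; lra.
have ht : lambda3 R = (1 + t)^-1.
  by apply: (mulfI t1); rewrite lambda3_ratio3 divff.
have := lambda3_quartic R; rewrite /= ht => h.
suff -> : (t ^+ 2 - 1) ^+ 2 = t + t ^+ 2 - t ^+ 3 - (1 + t) ^+ 4 *
  ((1 + t)^-1 ^+ 4 - 4 * (1 + t)^-1 ^+ 3 + 3 * (1 + t)^-1 - 1).
  by rewrite h mulr0 subr0.
by field.
Qed.

(** The indices h, i, j, k are consecutive, with no jump from i to j and a jump from j
    to k.  Up to constants the hypotheses give b_k <= t b_j and b_i <= t b_h, then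
    b_i <= (t^2 - 1) b_j, and from the jump to k out of the space of the i-th triple
    b_h + (1 + t) b_j <= t b_i + t b_k.  Eliminating b_h, b_k and b_i leaves
    (t + t^2 - t^3) b_j <= (t^2 - 1)^2 b_j, an equality of coefficients, so only the
    constants and the multiple of [g], which stands for log c, survive. *)
Lemma critical_exponents (R : realType) (t K g : R)
    (bh bi bj bk ai aj ak sh si sj sk ri rj : R) :
  1 < t -> (t ^+ 2 - 1) ^+ 2 = t + t ^+ 2 - t ^+ 3 -> 0 <= K -> g <= 0 ->
  bh <= ai -> bi <= aj -> bj <= ak ->
  (1 + t) * sh <= (1 + t) * g - bh -> (1 + t) * si <= (1 + t) * g - bi ->
  (1 + t) * sj <= (1 + t) * g - bj -> (1 + t) * sk <= (1 + t) * g - bk ->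
  (1 + t) * ri <= (1 + t) * g - ai -> (1 + t) * rj <= (1 + t) * g - aj ->
  0 <= K + bh + sh + si -> 0 <= K + bj + sj + sk ->
  0 <= K + bj + sj + rj + bk + sk - ak ->
  0 <= K + bi + si + ri + bk + sk - ak ->
  0 <= ((t ^+ 2 - 1) * (1 + t) ^+ 2 + (1 + t + t ^+ 2) * (1 + t)) * K
       + 3 * t * (1 + t) * g.
Proof.
move=> t1 tE K0 g0 hai haj hak hsh hsi hsj hsk hri hrj A1 A2 D1 D2.
set T := 1 + t; have T0 : 0 < T by rewrite /T; lra.
have scale x : 0 <= x -> 0 <= T * x by move=> ?; apply: mulr_ge0 => //; exact: ltW.
have Tg : T * g <= 0 by nra.
have TK : 0 <= T * K by nra.
have e1 : bi <= t * bh + T * K.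
  by have := scale _ A1; rewrite /T in Tg TK *; lra.
have e2 : bk <= t * bj + T * K.
  by have := scale _ A2; rewrite /T in Tg TK *; lra.
have e3 : bi + bj <= t * bk + T * K.
  have : 0 <= t * (ak - bj) by apply: mulr_ge0; lra.
  by have := scale _ D1; rewrite /T in Tg TK *; lra.
have e4 : bh + T * bj <= t * bi + t * bk + T * K + 3 * (T * g).
  have : 0 <= t * (ak - bj) by apply: mulr_ge0; lra.
  by have := scale _ D2; rewrite /T in Tg TK *; lra.
have e5 : bi <= (t ^+ 2 - 1) * bj + T ^+ 2 * K.
  have : 0 <= t * (t * bj + T * K - bk) by apply: mulr_ge0; lra.
  by rewrite /T in e3 *; lra.
have e6 : (t + t ^+ 2 - t ^+ 3) * bj <=
    (t ^+ 2 - 1) * bi + (1 + t + t ^+ 2) * T * K + 3 * t * T * g.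
  have : 0 <= t * (t * bi + t * bk + T * K + 3 * (T * g) - bh - T * bj).
    by apply: mulr_ge0; lra.
  have : 0 <= t ^+ 2 * (t * bj + T * K - bk) by apply: mulr_ge0; [nra|lra].
  by rewrite /T in e1 *; lra.
have : 0 <= (t ^+ 2 - 1) * ((t ^+ 2 - 1) * bj + T ^+ 2 * K - bi).
  by apply: mulr_ge0; [nra|lra].
have : (t + t ^+ 2 - t ^+ 3) * bj = (t ^+ 2 - 1) ^+ 2 * bj by rewrite tE.
by rewrite /T in e6 *; lra.
Qed.

(** * Linear inequalities between exponents *)

(** If the chain always jumps, the height of y_(n+1) is at most that of z_(n+1) to the
    power t^2 / (1 + t), up to constants. *)
Lemma steady_slack (R : realType) (t K bf bg bh ag ah : R) :
  1 < t -> 0 <= K ->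
  bf <= ag -> bg <= ah -> bg <= t * bf + (1 + t) * K ->
  (1 + t) * (ag + ah) <= t * (bf + bg + bh) + 2 * (1 + t) * K ->
  (1 + t) * ah <= t ^+ 2 * bh + (1 + 2 * t) * (1 + t) * K.
Proof.
move=> t1 K0 hag hah A B.
have : 0 <= t * (1 + t) * (ag - bf) by apply: mulr_ge0; [nra|lra].
have : 0 <= t * (t * (bf + bg + bh) + 2 * (1 + t) * K - (1 + t) * (ag + ah)).
  by apply: mulr_ge0; lra.
have : 0 <= (t ^+ 2 - 1) * (ah - bg) by apply: mulr_ge0; [nra|lra].
by lra.
Qed.

(** The exponent of one of the two terms in the determinant of C(y_h, z_h) and
    C(y_i, z_i).  The coefficient of b_h is negative because
    t^2 (t^2 + 2 t - 2) < 2 (1 + t) for t < 19/14; the margin is slim, hence 1/200. *)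
Lemma steady_det1 (R : realType) (t K bg bh bi ah ai : R) :
  1 < t < 19 / 14 -> 0 <= K -> 0 <= bh -> bg <= ah -> bh <= ai ->
  (1 + t) * ah <= t ^+ 2 * bh + (1 + 2 * t) * (1 + t) * K ->
  (1 + t) * (ah + ai) <= t * (bg + bh + bi) + 2 * (1 + t) * K ->
  t * (1 + t) * ((t - 2) * bi + t * bh + (1 + t) * (ah - ai))
    <= 100 * K - bh / 200.
Proof.
move=> /andP[t1 t2] K0 bh0 hah hai S B.
have e1 : ah + ai <= t * bi + 2 * (1 + t) * K.
  have : 0 <= t * (ah - bg) by apply: mulr_ge0; lra.
  have : 0 <= t * (ai - bh) by apply: mulr_ge0; lra.
  by lra.
have e2 : 0 <= (1 + t) * (2 - t) * (t * bi + 2 * (1 + t) * K - (ah + ai)).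
  by apply: mulr_ge0; [nra|lra].
have e3 : 0 <= (1 + t) * (2 + t ^+ 2) * (ai - bh) by apply: mulr_ge0; [nra|lra].
have e4 : 0 <= (t ^+ 2 + 2 * t - 2) *
    (t ^+ 2 * bh + (1 + 2 * t) * (1 + t) * K - (1 + t) * ah).
  by apply: mulr_ge0; [nra|lra].
have c1 : t ^+ 2 * (t ^+ 2 + 2 * t - 2) - 2 * (1 + t) <= - (1 / 200).
  (* Comparison with the value at 19/14, where the left-hand side is about -0.0063. *)
  have -> : t ^+ 2 * (t ^+ 2 + 2 * t - 2) - 2 * (1 + t) =
    (19 / 14) ^+ 2 * ((19 / 14) ^+ 2 + 2 * (19 / 14) - 2) - 2 * (1 + 19 / 14)
    - (19 / 14 - t) * ((t + 19 / 14) * (t ^+ 2 + 2 * t - 2)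
       + (19 / 14) ^+ 2 * (t + 19 / 14 + 2) - 2) by field.
  have : 0 <= (19 / 14 - t) * ((t + 19 / 14) * (t ^+ 2 + 2 * t - 2)
       + (19 / 14) ^+ 2 * (t + 19 / 14 + 2) - 2).
    apply: mulr_ge0; first by lra.
    have : 0 <= (t + 19 / 14) * (t ^+ 2 + 2 * t - 2).
      by apply: mulr_ge0; [lra|nra].
    by lra.
  by lra.
have e5 : 0 <= (- (1 / 200) - (t ^+ 2 * (t ^+ 2 + 2 * t - 2) - 2 * (1 + t))) * bh.
  by apply: mulr_ge0; lra.
have c2 : (1 + t) * (2 - t) * (2 * (1 + t)) +
    (t ^+ 2 + 2 * t - 2) * ((1 + 2 * t) * (1 + t)) <= 100.
  have h1 : 0 <= t ^+ 2 <= 2 by apply/andP; split; nra.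
  have : (1 + t) * (2 - t) * (2 * (1 + t)) <= 12.
    have : (1 + t) * (2 - t) <= 2 by nra.
    have : 0 <= (1 + t) * (2 - t) by nra.
    by nra.
  have : (t ^+ 2 + 2 * t - 2) * ((1 + 2 * t) * (1 + t)) <= 3 * 12.
    apply: ler_pM; nra.
  lra.
have e6 : 0 <= (100 - ((1 + t) * (2 - t) * (2 * (1 + t)) +
    (t ^+ 2 + 2 * t - 2) * ((1 + 2 * t) * (1 + t)))) * K.
  by apply: mulr_ge0; lra.
by lra.
Qed.

(** The exponent of the other term of that determinant. *)
Lemma steady_det2 (R : realType) (t K bh bi bj ai aj : R) :
  1 < t < 19 / 14 -> 0 <= K -> 0 <= bi -> bh <= ai -> bi <= aj ->
  (1 + t) * ai <= t ^+ 2 * bi + (1 + 2 * t) * (1 + t) * K ->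
  (1 + t) * (ai + aj) <= t * (bh + bi + bj) + 2 * (1 + t) * K ->
  t * (1 + t) * ((t - 1) * bh + t * bi - bj + (1 + t) * (ai - aj))
    <= 100 * K - bi / 200.
Proof.
move=> /andP[t1 t2] K0 bi0 hai haj S B.
have e1 : ai + aj <= t * bj + 2 * (1 + t) * K.
  have : 0 <= t * (ai - bh) by apply: mulr_ge0; lra.
  have : 0 <= t * (aj - bi) by apply: mulr_ge0; lra.
  by lra.
have e2 : 0 <= (1 + t) * (t * bj + 2 * (1 + t) * K - (ai + aj)).
  by apply: mulr_ge0; lra.
have e3 : 0 <= (1 + t) * (1 + t * (1 + t)) * (aj - bi).
  by apply: mulr_ge0; [nra|lra].
have e3' : 0 <= (1 + t) * t * (t - 1) * (ai - bh).
  by apply: mulr_ge0; [nra|lra].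
have e4 : 0 <= (2 * t ^+ 2 - 1) *
    (t ^+ 2 * bi + (1 + 2 * t) * (1 + t) * K - (1 + t) * ai).
  by apply: mulr_ge0; [nra|lra].
have h1 : 0 <= t ^+ 2 <= 361 / 196 by apply/andP; split; nra.
have c1 : t ^+ 2 * (2 * t ^+ 2 - 1) - (1 + t) ^+ 2 <= - (1 / 200) by nra.
have e5 : 0 <= (- (1 / 200) - (t ^+ 2 * (2 * t ^+ 2 - 1) - (1 + t) ^+ 2)) * bi.
  by apply: mulr_ge0; lra.
have c2 : (1 + t) * (2 * (1 + t)) +
    (2 * t ^+ 2 - 1) * ((1 + 2 * t) * (1 + t)) <= 100.
  have : (1 + t) * (2 * (1 + t)) <= 12 by nra.
  have : (2 * t ^+ 2 - 1) * ((1 + 2 * t) * (1 + t)) <= 3 * 12.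
    apply: ler_pM; nra.
  lra.
have e6 : 0 <= (100 - ((1 + t) * (2 * (1 + t)) +
    (2 * t ^+ 2 - 1) * ((1 + 2 * t) * (1 + t)))) * K.
  by apply: mulr_ge0; lra.
by lra.
Qed.

(** The logarithmic form of the estimates along a chain: [a n], [b n], [r n], [s n] are
    the logarithms of height(y_n), height(z_n), err(p_n), err(y_n), [g] is the
    logarithm of the approximation constant, and [J n] means that z_(n+1) is outside
    the space of the n-th triple.  [es_indep] expresses that the determinants of
    consecutive vectors C(y_n, z_n) cannot tend to zero; its two expressions bound, up to
    constants, the logarithms of the two terms of such a determinant. *)
Record exponent_system (R : realType) (t K g : R) (J : nat -> bool)
    (a b r s : nat -> R) : Prop := ExponentSystem {
  es_ge0 : forall n, 0 <= b n;
  es_lim : forall M, exists N, forall n, (N <= n)%N -> M <= b n;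
  es_order : forall n, b n <= a n.+1;
  es_errY : forall n, (1 + t) * s n <= (1 + t) * g - b n;
  es_errP : forall n, (1 + t) * r n <= (1 + t) * g - a n;
  es_plane : forall n, a n.+1 + r n.+1 <= K + b n + s n;
  es_cubic : forall n, 0 <= K + b n + s n + s n.+1;
  es_jump : forall n, J n ->
    0 <= K + b n + s n + r n + b n.+1 + s n.+1 - a n.+1;
  es_jump2 : forall n, ~~ J n -> J n.+1 ->
    0 <= K + b n + s n + r n + b n.+2 + s n.+2 - a n.+2;
  es_inf : forall N, exists2 n, (N <= n)%N & J n;
  es_indep : ~ (forall M, exists N, forall n, (N <= n)%N ->
    b n.+1 + 2 * s n.+1 + (a n + s n + s n.+1 + b n - a n.+1) <= - M /\
    b n + 2 * s n + (a n.+1 + s n.+1 + s n.+2 + b n.+1 - a n.+2) <= - M)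
}.

(** When every index is a jump, [es_jump] and [es_plane] combine to an inequality
    between three consecutive triples, from which [steady_det1] and [steady_det2]
    contradict [es_indep]. *)
Lemma exponent_system_steady (R : realType) (t K g : R) (J : nat -> bool)
    (a b r s : nat -> R) (N : nat) :
  1 < t < 19 / 14 -> 0 <= K -> g <= 0 -> exponent_system t K g J a b r s ->
  (forall n, (N <= n)%N -> J n) -> False.
Proof.
move=> ht K0 g0 E hJ; apply: (es_indep E) => M.
have /andP[t1 t2] := ht.
have T0 : 0 <= 1 + t by lra.
have g1 : 0 <= (1 + t) * - g by apply: mulr_ge0; lra.
have bnd n : (1 + t) * (b n + s n) <= t * b n.
  by have := es_errY E n; lra.
have bnd' n : (1 + t) * s n <= - b n.
  by have := es_errY E n; lra.
have A n : b n.+1 <= t * b n + (1 + t) * K.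
  have : 0 <= (1 + t) * (K + b n + s n + s n.+1) by apply: mulr_ge0 => //; exact: es_cubic E n.
  by have := bnd n; have := bnd' n.+1; lra.
have B n : (N <= n)%N -> (1 + t) * (a n.+1 + a n.+2) <=
    t * (b n + b n.+1 + b n.+2) + 2 * (1 + t) * K.
  move=> Nn; have h1 : 0 <= (1 + t) * (K + b n.+1 + s n.+1 + r n.+1 + b n.+2 + s n.+2 - a n.+2).
    by apply: mulr_ge0 => //; apply: (es_jump E); rewrite hJ // ltnW.
  have : 0 <= (1 + t) * (K + b n + s n - a n.+1 - r n.+1).
    by apply: mulr_ge0 => //; have := es_plane E n; lra.
  by have := bnd n; have := bnd n.+1; have := bnd n.+2; lra.
have S n : (N <= n)%N -> (1 + t) * a n.+2 <= t ^+ 2 * b n.+2 + (1 + 2 * t) * (1 + t) * K.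
  move=> Nn; apply: (steady_slack t1 K0 (es_order E n) (es_order E n.+1) (A n)).
  exact: B.
have [N1 hN1] := es_lim E (200 * (100 * K + 10 * `|M|)).
have [M1 M2] : M <= `|M| /\ 0 <= `|M| by split; [exact: ler_norm|].
have key x : t * (1 + t) * ((1 + t) * x) <= - (10 * `|M|) -> x <= - M.
  move=> h; apply: le_trans (_ : - `|M| <= _); last by lra.
  rewrite leNgt; apply/negP => hx.
  have : 0 < t * (1 + t) * (1 + t) * (x + `|M|) by apply: mulr_gt0; [nra|lra].
  have : 0 <= (10 - t * (1 + t) * (1 + t)) * `|M| by apply: mulr_ge0; [nra|lra].
  lra.
exists (maxn N1 N.+2) => n; rewrite geq_max => /andP[n1].
case: n n1 => [|[|n]] // n1; rewrite !ltnS => n2.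
have hb1 := hN1 _ n1.
have hb2 : 200 * (100 * K + 10 * `|M|) <= b n.+3 by apply: hN1; exact: leqW.
split; apply: key.
- have := steady_det1 (K := K) ht K0 (es_ge0 E n.+2) (es_order E n.+1) (es_order E n.+2)
    (S n n2) (B n.+1 (leqW n2)).
  have : 0 <= t * (1 + t) * ((t - 2) * b n.+3 + t * b n.+2 + (1 + t) * (a n.+2 - a n.+3)
     - (1 + t) * (b n.+3 + 2 * s n.+3 + (a n.+2 + s n.+2 + s n.+3 + b n.+2 - a n.+3))).
    by apply: mulr_ge0; [nra | have := bnd' n.+2; have := bnd' n.+3; lra].
  by lra.
- have := steady_det2 (K := K) ht K0 (es_ge0 E n.+3) (es_order E n.+2) (es_order E n.+3)
    (S n.+1 (leqW n2)) (B n.+2 (leqW (leqW n2))).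
  have : 0 <= t * (1 + t) * ((t - 1) * b n.+2 + t * b n.+3 - b n.+4 + (1 + t) * (a n.+3 - a n.+4)
     - (1 + t) * (b n.+2 + 2 * s n.+2 + (a n.+3 + s n.+3 + s n.+4 + b n.+3 - a n.+4))).
    apply: mulr_ge0; [nra | have := bnd' n.+2; have := bnd' n.+3; have := bnd' n.+4; lra].
  by lra.
Qed.

(** Since jumps occur infinitely often but not always from some index on, some jump
    follows an index that is not a jump. *)
Lemma exponent_system_bound (R : realType) (t K g : R) (J : nat -> bool)
    (a b r s : nat -> R) :
  1 < t < 19 / 14 -> (t ^+ 2 - 1) ^+ 2 = t + t ^+ 2 - t ^+ 3 ->
  0 <= K -> g <= 0 -> exponent_system t K g J a b r s ->
  0 <= ((t ^+ 2 - 1) * (1 + t) ^+ 2 + (1 + t + t ^+ 2) * (1 + t)) * K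
       + 3 * t * (1 + t) * g.
Proof.
move=> ht tE K0 g0 E; have /andP[t1 _] := ht.
have [n n1 /andP[Jn Jn1]] : exists2 n, (1 <= n)%N & ~~ J n && J n.+1.
  apply: contrapT => hno.
  have step n : (1 <= n)%N -> J n.+1 -> J n.
    move=> n1 Jn1; apply: contrapT => /negP nJ.
    by apply: hno; exists n => //; rewrite nJ.
  apply: (exponent_system_steady (N := 1) ht K0 g0 E) => n n1.
  have [m nm Jm] := es_inf E n.
  elim: (m - n)%N {-2}n (subnKC nm) n1 => [|k IH] i; first by rewrite addn0 => ->.
  by rewrite addnS -addSn => h i1; apply: step => //; apply: IH.
case: n n1 Jn Jn1 => // n _ Jn Jn1.
apply: (critical_exponents t1 tE K0 g0 (es_order E n) (es_order E n.+1) (es_order E n.+2)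
  (es_errY E n) (es_errY E _) (es_errY E _) (es_errY E _) (es_errP E _) (es_errP E _)
  (es_cubic E n) (es_cubic E n.+2) (es_jump E Jn1) (es_jump2 E Jn Jn1)).
Qed.

(** * The exponent system of a chain *)

(** A recurrence satisfied by a point [u] is proportional to the one given by the
    Hankel minors of [u]. *)
Lemma hankel_proportional (R : realType) (a b c : R) (u v : 'rV[R]_4) :
  ~ (a = 0 /\ b = 0 /\ c = 0) -> annihilates a b c u -> annihilates a b c v ->
  annihilates (hankel_a u) (hankel_b u) (hankel_c u) v.
Proof.
move=> abc [u1 u2] [v1 v2].
have ab : a * hankel_b u = b * hankel_a u.
  transitivity (b * hankel_a u + u 0 2 * (a * u 0 1 + b * u 0 2 + c * u 0 3)
    - u 0 3 * (a * u 0 0 + b * u 0 1 + c * u 0 2)).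
    by rewrite /hankel_a /hankel_b; ring.
  by rewrite u1 u2; ring.
have ac : a * hankel_c u = c * hankel_a u.
  transitivity (c * hankel_a u - u 0 1 * (a * u 0 1 + b * u 0 2 + c * u 0 3)
    + u 0 2 * (a * u 0 0 + b * u 0 1 + c * u 0 2)).
    by rewrite /hankel_a /hankel_c; ring.
  by rewrite u1 u2; ring.
have bc : b * hankel_c u = c * hankel_b u.
  transitivity (c * hankel_b u + u 0 0 * (a * u 0 1 + b * u 0 2 + c * u 0 3)
    - u 0 1 * (a * u 0 0 + b * u 0 1 + c * u 0 2)).
    by rewrite /hankel_b /hankel_c; ring.
  by rewrite u1 u2; ring.
have key w0 w1 w2 : a * w0 + b * w1 + c * w2 = 0 ->
    hankel_a u * w0 + hankel_b u * w1 + hankel_c u * w2 = 0.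
  move=> hw; set h := (X in X = 0).
  have ha : a * h = 0.
    by rewrite /h !mulrDr !mulrA ab ac -[RHS](mulr0 (hankel_a u)) -hw; ring.
  have hb : b * h = 0.
    by rewrite /h !mulrDr !mulrA -ab bc -[RHS](mulr0 (hankel_b u)) -hw; ring.
  have hc : c * h = 0.
    by rewrite /h !mulrDr !mulrA -ac -bc -[RHS](mulr0 (hankel_c u)) -hw; ring.
  apply/eqP; apply: contrapT => /negP h0; apply: abc.
  by move/eqP: ha; move/eqP: hb; move/eqP: hc; rewrite !mulf_eq0 (negbTE h0) !orbF
    => /eqP -> /eqP -> /eqP ->.
by split; apply: key.
Qed.

Lemma normal_orthogonal (R : realType) (a0 a1 a2 a3 : R) (p y z w : 'rV[R]_4) :
  ~~ coplanar p y z ->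
  dot4 a0 a1 a2 a3 p = 0 -> dot4 a0 a1 a2 a3 y = 0 -> dot4 a0 a1 a2 a3 z = 0 ->
  det4 p y z w = 0 -> dot4 a0 a1 a2 a3 w = 0.
Proof.
move=> ncop hp hy hz; rewrite /det4.
have [] := normal_proportional hp hy hz.
move: ncop; rewrite /coplanar.
move: (normal0 p y z) (normal1 p y z) (normal2 p y z) (normal3 p y z) => n0 n1 n2 n3.
move=> ncop [e01 e02 e03] [e12 e13 e23]; rewrite /dot4 => hn.
set d := (X in X = 0).
have k0 : n0 * d = 0.
  transitivity (a0 * (n0 * w 0 0 + n1 * w 0 1 + n2 * w 0 2 + n3 * w 0 3)
   - (a0 * n1 - a1 * n0) * w 0 1 - (a0 * n2 - a2 * n0) * w 0 2
   - (a0 * n3 - a3 * n0) * w 0 3); first by rewrite /d; ring.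
  by rewrite hn e01 e02 e03; ring.
have k1 : n1 * d = 0.
  transitivity (a1 * (n0 * w 0 0 + n1 * w 0 1 + n2 * w 0 2 + n3 * w 0 3)
   + (a0 * n1 - a1 * n0) * w 0 0 - (a1 * n2 - a2 * n1) * w 0 2
   - (a1 * n3 - a3 * n1) * w 0 3); first by rewrite /d; ring.
  by rewrite hn e01 e12 e13; ring.
have k2 : n2 * d = 0.
  transitivity (a2 * (n0 * w 0 0 + n1 * w 0 1 + n2 * w 0 2 + n3 * w 0 3)
   + (a0 * n2 - a2 * n0) * w 0 0 + (a1 * n2 - a2 * n1) * w 0 1
   - (a2 * n3 - a3 * n2) * w 0 3); first by rewrite /d; ring.
  by rewrite hn e02 e12 e23; ring.
have k3 : n3 * d = 0.
  transitivity (a3 * (n0 * w 0 0 + n1 * w 0 1 + n2 * w 0 2 + n3 * w 0 3)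
   + (a0 * n3 - a3 * n0) * w 0 0 + (a1 * n3 - a3 * n1) * w 0 1
   + (a2 * n3 - a3 * n2) * w 0 2); first by rewrite /d; ring.
  by rewrite hn e03 e13 e23; ring.
apply/eqP; apply: contrapT => /negP d0; case/negP: ncop.
by move/eqP: k0; move/eqP: k1; move/eqP: k2; move/eqP: k3;
  rewrite !mulf_eq0 (negbTE d0) !orbF => -> -> -> ->.
Qed.

Lemma normal_neq0 (R : realType) (p y z : 'rV[R]_4) : ~~ coplanar p y z ->
  ~ (normal0 p y z = 0 /\ normal1 p y z = 0 /\ normal2 p y z = 0 /\ normal3 p y z = 0).
Proof.
by rewrite /coplanar => /negP h [h0 [h1 [h2 h3]]]; apply: h; rewrite h0 h1 h2 h3 eqxx.
Qed.

Section ChainSystem.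
Variables (R : realType) (xi : R).
Hypothesis hxi : extension_degree_gt xi 3.
Variables (D l t : R) (p y z : nat -> 'rV[R]_4).
Hypothesis ch : chain xi D l p y z.
Hypothesis D01 : 0 < 2 * D <= 1.
Hypothesis lt1 : (1 + t) * l = 1.
Hypothesis t_range : 1 < t < 19 / 14.
Hypothesis rk : forall n, ~ (hankel_b (y n) = 0 /\ hankel_c (y n) = 0).
Hypothesis nonspecial : forall n, ~ (cov_lo (y n) (z n) = 0 /\ cov_hi (y n) (z n) = 0).
Implicit Types u v w : 'rV[R]_4.

Let B := 1 + `|xi|.
Let a n := ln (height (y n)).
Let b n := ln (height (z n)).
Let r n := ln (err xi (p n)).
Let s n := ln (err xi (y n)).
Let J n := det4 (p n) (y n) (z n) (z n.+1) != 0.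
Let K := ln 4 + ln (8 * B ^+ 2) + ln 36.

(** A recurrence that annihilates p_(n+1) and y_(n+1) annihilates the whole plane, hence
    y_n and z_n; so C(y_(n+1), p_(n+1)) is nonzero. *)
Lemma cs_cubic n : 0 <= ln 4 + ln (8 * B ^+ 2) + b n + s n + s n.+1.
Proof.
have nback : ~ (cov_lo (y n.+1) (p n.+1) = 0 /\ cov_hi (y n.+1) (p n.+1) = 0).
  move=> hp; apply: (nonspecial (n := n)).
  have hy := hankel_annihilates (y n.+1).
  have [s1 [t1 E1]] := ch_spanY ch n; have [s2 [t2 E2]] := ch_spanZ ch n.
  apply: (@hankel_proportional R (hankel_a (y n.+1)) (hankel_b (y n.+1)) (hankel_c (y n.+1))).
  - by move=> [_ h]; exact: rk h.
  - by rewrite [in X in annihilates _ _ _ X]E1; apply: annihilates_lin.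
  - by rewrite [in X in annihilates _ _ _ X]E2; apply: annihilates_lin.
have := cov_back_bound hxi ch nback; rewrite -/B.
have := ch_area_ln hxi ch n.
by rewrite /b /s; lra.
Qed.

Lemma normal_int u v w : integral_point u -> integral_point v -> integral_point w ->
  [/\ normal0 u v w \is a Num.int, normal1 u v w \is a Num.int,
      normal2 u v w \is a Num.int & normal3 u v w \is a Num.int].
Proof.
move=> iu iv iw; rewrite /normal0 /normal1 /normal2 /normal3 !rpredN /det3.
by split; prove_int.
Qed.

Lemma cs_jump n k : (n < k)%N -> det4 (p n) (y n) (z n) (y k) = 0 ->
  det4 (p n) (y n) (z n) (z k) != 0 ->
  0 <= ln 36 + b n + s n + r n + b k + s k - a k.
Proof.
move=> nk h0 h1.
have i1 : det4 (p n) (y n) (z n) (z k) \is a Num.int.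
  have [j0 j1 j2 j3] := normal_int (ch_intP ch n) (ch_intY ch n) (ch_intZ ch n).
  have iz := ch_intZ ch k.
  by rewrite /det4 /dot4; prove_int.
have [pn yn zn] := ch_height_pos ch n; have [pk yk zk] := ch_height_pos ch k.
have [epn eyn] := ch_err_pos hxi ch n; have [epk eyk] := ch_err_pos hxi ch k.
have := det4_jump (ltW (lt_trans (ch_heightY ch n) (ch_heightZ ch n))) (ltW (ch_heightZ ch n))
  (ltW (ch_errZ ch n)) (ltW (ch_errY ch n)) yk (ltW (ch_heightZ ch k)) (ltW (ch_errZ ch k))
  h0 (norm_intr_ge1 i1 h1).
rewrite -ler_ln ?posrE ?mulr_gt0 //.
rewrite lnM ?posrE ?mulr_gt0 // lnM ?posrE ?mulr_gt0 // lnM ?posrE ?mulr_gt0 //.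
rewrite lnM ?posrE ?mulr_gt0 // lnM ?posrE ?mulr_gt0 //.
by rewrite /a /b /s /r; lra.
Qed.

Lemma cs_det4_next n : det4 (p n) (y n) (z n) (y n.+1) = 0 /\
  det4 (p n) (y n) (z n) (p n.+1) = 0.
Proof.
split; last by apply: dot4_in_span (ch_spanP ch n) _ _; [exact: det4_2|exact: det4_3].
have [s' [t' [_ _ E]]] := ch_next ch n.
by apply: (@dot4_in_span R _ _ _ _ (y n) (z n));
  [exists s', t'|exact: det4_2|exact: det4_3].
Qed.

(** Without jumps all later points would remain in the space of the triple of index N,
    contrary to [not_in_hyperplane]. *)
Lemma cs_inf N : exists2 n, (N <= n)%N & J n.
Proof.
apply: contrapT => hno.
have noJ n : (N <= n)%N -> det4 (p n) (y n) (z n) (z n.+1) = 0.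
  by move=> Nn; apply/eqP; apply: contrapT => /negP h; apply: hno; exists n.
have [i0 i1 i2 i3] := normal_int (ch_intP ch N) (ch_intY ch N) (ch_intZ ch N).
set a0 := normal0 (p N) (y N) (z N) in i0; set a1 := normal1 (p N) (y N) (z N) in i1.
set a2 := normal2 (p N) (y N) (z N) in i2; set a3 := normal3 (p N) (y N) (z N) in i3.
have step n : [/\ dot4 a0 a1 a2 a3 (p (n + N)) = 0, dot4 a0 a1 a2 a3 (y (n + N)) = 0
   & dot4 a0 a1 a2 a3 (z (n + N)) = 0].
  elim: n => [|n [h1 h2 h3]].
    by split; [exact: det4_1|exact: det4_2|exact: det4_3].
  have ncop := ch_indep ch (n + N).
  have [d1 d2] := cs_det4_next (n + N).
  split; apply: (normal_orthogonal ncop h1 h2 h3) => //.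
  by apply: noJ; exact: leq_addl.
have [] := normal_neq0 (ch_indep ch N).
apply: (not_in_hyperplane hxi (x := fun n => y (n + N)%N)) => //.
- by move=> n; case: (ch_small ch (n + N)).
- move=> M; exists (Num.bound `|M|).
  have h1 : `|M| < (Num.bound `|M|)%:R by exact: archi_boundP.
  have h2 := ch_lim ch (Num.bound `|M| + N); rewrite natrD in h2.
  have := ch_heightY ch (Num.bound `|M| + N).
  by have := ler_norm M; have := ler0n R N; lra.
- by move=> n; case: (step n).
Qed.

(** Without a jump at n the triples n and n+1 span the same space, so z_(n+2) is also
    outside the space of the triple n, while y_(n+2) is inside. *)
Lemma cs_jump2 n : ~~ J n -> J n.+1 ->
  0 <= ln 36 + b n + s n + r n + b n.+2 + s n.+2 - a n.+2.
Proof.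
move=> /negPn/eqP J1 J2; have [d1 d2] := cs_det4_next n.
apply: cs_jump; first exact: leqW.
- have [s' [t' [_ _ E]]] := ch_next ch n.+1.
  by apply: (@dot4_in_span R _ _ _ _ (y n.+1) (z n.+1)); [exists s', t'| |].
- apply: contra J2 => /eqP h; apply/eqP.
  exact: (orthogonal_normal (normal_neq0 (ch_indep ch n)) d2 d1 J1 h).
Qed.

Let V n := 8 * B ^+ 2 * (height (z n) * err xi (y n) ^+ 2).
Let W n := 24 * B ^+ 2 * (height (y n) * err xi (y n) * err xi (y n.+1)
  * height (z n) / height (y n.+1)).

Lemma cs_V n : `|cov_lo (y n) (z n)| <= V n /\ `|cov_hi (y n) (z n)| <= V n.
Proof.
have [p0 y0 z0] := ch_height_pos ch n; have [ep0 ey0] := ch_err_pos hxi ch n.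
have [ep1 ey1 ez1] := ch_small ch n.
have p1 := ch_heightP ch n; have py := ch_heightY ch n; have yz := ch_heightZ ch n.
have y1 : 1 <= height (y n) by lra.
have z1 : 1 <= height (z n) by lra.
have [b1 b2 _] := cov_le ey1 ez1 y1 z1.
have bE : 4 * (1 + `|xi|) ^+ 2 * (height (y n) * err xi (y n) * err xi (z n) +
   height (z n) * err xi (y n) ^+ 2) <= V n.
  rewrite /V -/B (_ : 8 * B ^+ 2 * _ = 4 * B ^+ 2 * (height (z n) * err xi (y n) * err xi (y n)
    + height (z n) * err xi (y n) ^+ 2)); last by ring.
  apply: ler_wpM2l; first by rewrite mulr_ge0 ?exprn_ge0 // addr_ge0.
  rewrite lerD2r; apply: ler_pM.
  - by apply: mulr_ge0; exact: ltW.
  - exact: err_ge0.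
  - by apply: ler_wpM2r; exact: ltW.
  - exact: ltW (ch_errZ ch n).
by split; [apply: le_trans b1 bE|apply: le_trans b2 bE].
Qed.

(** C(y_n, .) is linear and kills y_n, so passing from z_n to y_(n+1) multiplies it by
    the coefficient m of z_n in y_(n+1); comparing areas shows that |m| is at least
    about height(y_(n+1)) / height(z_n). *)
Lemma cs_multiplier n : exists2 m : R, height (y n.+1) <= 4 * height (z n) * `|m| &
  cov_lo (y n) (y n.+1) = m * cov_lo (y n) (z n) /\
  cov_hi (y n) (y n.+1) = m * cov_hi (y n) (z n).
Proof.
have [c [m [ic im E]]] := ch_next ch n.
have [p0 y0 z0] := ch_height_pos ch n; have [ep0 ey0] := ch_err_pos hxi ch n.
have yz := ch_heightZ ch n; have zy := ch_heightS ch n.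
have ez := ch_errZ ch n; have ezy := ch_errS ch n.
have [_ y0' _] := ch_height_pos ch n.+1.
exists m; last first.
  have [h1 h2] := cov_self (y n).
  by rewrite E; have [-> ->] := cov_lin (y n) c m (y n) (z n); rewrite h1 h2 !mulr0 !add0r.
have [b1 b2 b3] := wedge_le (ltW yz) (ltW ez).
have m1 : 1 <= `|m|.
  apply: norm_intr_ge1 => //; apply/eqP => m0.
  have E' : y n.+1 = c *: y n by rewrite E m0 scale0r addr0.
  have c1 : 1 <= `|c|.
    apply: norm_intr_ge1 => //; apply/eqP => c0.
    by move: y0'; rewrite E' c0 scale0r /height mxE normr0 ltxx.
  have := errZ xi c (y n); rewrite -E' => eE.
  have : 0 <= (`|c| - 1) * err xi (y n) by apply: mulr_ge0; lra.
  by lra.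
have far (k d f : R) : `|d| = err xi (y n) -> `|f| <= err xi (y n.+1) ->
   y n 0 0 * f - y n.+1 0 0 * d = m * k -> `|k| <= 2 * (height (z n) * err xi (y n)) ->
   height (y n.+1) - height (y n) <= 2 * height (z n) * `|m|.
  move=> hd hf hk kb.
  have h1 : height (y n.+1) * err xi (y n) - height (y n) * err xi (y n) <= `|m * k|.
    rewrite -hk -normrN opprB.
    have := lerB_dist (y n.+1 0 0 * d) (y n 0 0 * f); rewrite !normrM hd.
    have : height (y n) * `|f| <= height (y n) * err xi (y n).
      by apply: ler_wpM2l; [exact: ltW|lra].
    by rewrite /height; lra.
  have h2 : `|m * k| <= `|m| * (2 * (height (z n) * err xi (y n))).
    by rewrite normrM; apply: ler_wpM2l.
  by rewrite -(ler_pM2r ey0); lra.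
have hw := wedge_lin xi (y n) (z n) 1 0 c m.
rewrite /= scale1r scale0r addr0 mul1r mul0r subr0 -E in hw; case: hw => w1 w2 w3.
have main : height (y n.+1) - height (y n) <= 2 * height (z n) * `|m|.
  case: (err_attained xi (y n)) => h.
  - exact: (far _ _ _ (esym h) (delta1_le _ _) w1 b1).
  - exact: (far _ _ _ (esym h) (delta2_le _ _) w2 b2).
  - exact: (far _ _ _ (esym h) (delta3_le _ _) w3 b3).
have : height (z n) <= height (z n) * `|m| by rewrite ler_peMr // ltW.
by lra.
Qed.

(** Estimating C(y_n, y_(n+1)) and dividing by the multiplier is better than estimating
    C(y_n, z_n) directly, because err(y_(n+1)) can be much smaller than err(z_n). *)
Lemma cs_W n : `|cov_hi (y n) (z n) - xi * cov_lo (y n) (z n)| <= W n.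
Proof.
have [m hm [m1 m2]] := cs_multiplier n.
have [p0 y0 z0] := ch_height_pos ch n; have [ep0 ey0] := ch_err_pos hxi ch n.
have [_ ey1 _] := ch_small ch n; have [_ ey1' _] := ch_small ch n.+1.
have p1 := ch_heightP ch n; have py := ch_heightY ch n.
have p1' := ch_heightP ch n.+1; have py' := ch_heightY ch n.+1.
have y1 : 1 <= height (y n) by lra.
have y1' : 1 <= height (y n.+1) by lra.
have [_ _] := cov_le ey1 ey1' y1 y1'.
rewrite m1 m2 -/B (_ : m * _ - _ = m * (cov_hi (y n) (z n) - xi * cov_lo (y n) (z n)));
  last by ring.
rewrite normrM; set d := `|_ - _| => h.
have d0 : 0 <= d by exact: normr_ge0.
rewrite /W mulrA ler_pdivlMr; last by lra.
have h1 : d * height (y n.+1) <= d * (4 * height (z n) * `|m|) by apply: ler_wpM2l.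
have h2 : 4 * height (z n) * (`|m| * d) <= 4 * height (z n) *
   (6 * B ^+ 2 * (height (y n) * err xi (y n) * err xi (y n.+1))).
  by apply: ler_wpM2l => //; lra.
by lra.
Qed.

(** If the two terms of the determinants of consecutive vectors C(y_n, z_n) tended to
    zero, these integral determinants would eventually vanish, so all the vectors
    would be proportional to a fixed one, of nonzero distance to the line spanned by
    (1, xi); but [cs_W] makes that distance tend to zero along the sequence. *)
Lemma cs_indep : ~ (forall M, exists N, forall n, (N <= n)%N ->
    b n.+1 + 2 * s n.+1 + (a n + s n + s n.+1 + b n - a n.+1) <= - M /\
    b n + 2 * s n + (a n.+1 + s n.+1 + s n.+2 + b n.+1 - a n.+2) <= - M).
Proof.
move=> H.
have B0 : 0 < B := B_gt0 xi.
have pos n : [/\ 0 < height (y n), 0 < height (z n) & 0 < err xi (y n)].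
  by have [_ ? ?] := ch_height_pos ch n; have [_ ?] := ch_err_pos hxi ch n.
have Vp n : 0 < V n.
  by have [? ? ?] := pos n; rewrite /V !mulr_gt0 ?exprn_gt0.
have Wp n : 0 < W n.
  by have [? ? ?] := pos n; have [? ? ?] := pos n.+1;
    rewrite /W !mulr_gt0 ?invr_gt0 ?exprn_gt0.
set c := ln (8 * B ^+ 2) + ln (24 * B ^+ 2).
have lnVW i j : ln (V i * W j) = c + (b i + 2 * s i + (a j + s j + s j.+1 + b j - a j.+1)).
  have [yi zi ei] := pos i; have [yj zj ej] := pos j; have [yj' zj' ej'] := pos j.+1.
  have c1p : 0 < 8 * B ^+ 2 by rewrite mulr_gt0 ?exprn_gt0.
  have c2p : 0 < 24 * B ^+ 2 by rewrite mulr_gt0 ?exprn_gt0.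
  rewrite lnM ?posrE // /V /W /c.
  move: (8 * B ^+ 2) (24 * B ^+ 2) c1p c2p => c1 c2 c1p c2p.
  rewrite lnM ?posrE ?mulr_gt0 ?exprn_gt0 // [ln (_ * err _ _ ^+ 2)]lnM ?posrE ?exprn_gt0 //.
  rewrite lnXn // [ln (c2 * _)]lnM ?posrE ?mulr_gt0 ?invr_gt0 ?exprn_gt0 //.
  rewrite ln_div ?posrE ?mulr_gt0 // lnM ?posrE ?mulr_gt0 // lnM ?posrE ?mulr_gt0 //.
  by rewrite lnM ?posrE ?mulr_gt0 // /a /b /s; ring.
have small e : 0 < e -> exists N, forall n, (N <= n)%N ->
    V n.+1 * W n <= e /\ V n * W n.+1 <= e.
  move=> e0; have [N hN] := H (c - ln e); exists N => n /hN[h1 h2].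
  have ln_inj_le q : 0 < q -> ln q <= ln e -> q <= e by move=> q0; rewrite ler_ln ?posrE.
  by split; (apply: ln_inj_le; first exact: mulr_gt0 (Vp _) (Wp _)); rewrite lnVW; lra.
pose lo n := cov_lo (y n) (z n); pose hi n := cov_hi (y n) (z n).
have quarter : (0 : R) < 1 / 4 by [].
have [N hN] := small _ quarter.
have ivs n : lo n \is a Num.int /\ hi n \is a Num.int.
  by apply: cov_int; [exact: ch_intY ch n|exact: ch_intZ ch n].
have par n : (N <= n)%N -> lo n * hi n.+1 = lo n.+1 * hi n.
  move=> /hN[h1 h2]; apply/eqP; rewrite -subr_eq0; apply/eqP; apply: int_small_eq0.
    by have [? ?] := ivs n; have [? ?] := ivs n.+1; prove_int.
  have -> : lo n * hi n.+1 - lo n.+1 * hi n =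
    lo n * (hi n.+1 - xi * lo n.+1) - lo n.+1 * (hi n - xi * lo n) by ring.
  apply: (@le_lt_trans _ _ (V n * W n.+1 + V n.+1 * W n)); last by lra.
  apply: norm2_le; [by case: (cs_V n)|exact: cs_W|by case: (cs_V n.+1)|exact: cs_W].
have parN n : lo N * hi (n + N)%N = lo (n + N)%N * hi N.
  elim: n => [|n IH]; first by [].
  rewrite addSn; have E := par (n + N)%N (leq_addl _ _).
  have [h|h] := eqVneq (lo (n + N)%N) 0.
    have hh : hi (n + N)%N != 0 by apply/eqP => hh; exact: (nonspecial (conj h hh)).
    have l0 : lo (n + N).+1 = 0.
      by apply/eqP; move: E; rewrite h mul0r => /esym/eqP; rewrite mulf_eq0 (negbTE hh) orbF.
    have l1 : lo N = 0.
      by apply/eqP; move: IH; rewrite h mul0r => /eqP; rewrite mulf_eq0 (negbTE hh) orbF.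
    by rewrite l0 l1 !mul0r.
  apply: (mulfI h).
  transitivity (lo N * (lo (n + N)%N * hi (n + N).+1)); first by ring.
  by rewrite E; transitivity (lo (n + N).+1 * (lo N * hi (n + N)%N)); [ring|rewrite IH; ring].
set k := hi N - xi * lo N.
have k0 : 0 < `|k|.
  rewrite normr_gt0; apply/eqP => k0; have [i1 i2] := ivs N.
  have rel : hi N + (- lo N) * xi + 0 * xi ^+ 2 + 0 * xi ^+ 3 = 0 by rewrite -[RHS]k0 /k; ring.
  have i1' : - lo N \is a Num.int by rewrite rpredN.
  have [e1 e2 _ _] := no_integer_relation hxi i2 i1' (rpred0 _) (rpred0 _) rel.
  apply: (nonspecial (n := N)); split => //.
  by apply: oppr_inj; rewrite oppr0.
have kV : 0 < `|k| / (2 * V N) by apply: divr_gt0 => //; exact: mulr_gt0.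
have [N' hN'] := small _ kV.
have [h1 _] := hN' (N' + N)%N (leq_addr _ _).
set n := (N' + N)%N in h1.
have V1 : 1 <= V n.+1.
  have [v1 v2] := cs_V n.+1.
  by case: (cov_pos (ch_intY ch n.+1) (ch_intZ ch n.+1) (nonspecial (n := n.+1))) => h;
    [apply: le_trans h v1|apply: le_trans h v2].
have W1 : W n <= `|k| / (2 * V N).
  by apply: le_trans h1; rewrite ler_peMl // ltW.
have [V2 V3] := cs_V N.
have kk : `|k| <= V N * W n.
  case: (cov_pos (ch_intY ch n) (ch_intZ ch n) (nonspecial (n := n))) => h.
    apply: (@le_trans _ _ (`|lo n| * `|k|)); first by rewrite ler_peMl.
    rewrite -normrM (_ : lo n * k = lo N * (hi n - xi * lo n)); last first.
      by rewrite /k mulrBr -(parN N') -/n; ring.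
    by rewrite normrM; apply: ler_pM => //; exact: cs_W.
  apply: (@le_trans _ _ (`|hi n| * `|k|)); first by rewrite ler_peMl.
  rewrite -normrM (_ : hi n * k = hi N * (hi n - xi * lo n)); last first.
    rewrite /k !mulrBr; have := parN N'; rewrite -/n => E.
    rewrite (_ : hi n * (xi * lo N) = xi * (lo N * hi n)); last by ring.
    by rewrite E; ring.
  by rewrite normrM; apply: ler_pM => //; exact: cs_W.
have : V N * W n <= V N * (`|k| / (2 * V N)) by apply: ler_wpM2l => //; exact: ltW.
have -> : V N * (`|k| / (2 * V N)) = `|k| / 2 by field; exact: lt0r_neq0.
by lra.
Qed.

Lemma chain_exponent_system : exponent_system t K (ln (2 * D)) J a b r s.
Proof.
have l4 : 0 <= ln 4 :> R by rewrite ln_ge0 // ler1n.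
have l36 : 0 <= ln 36 :> R by rewrite ln_ge0 // ler1n.
have lB : 0 <= ln (8 * B ^+ 2).
  rewrite ln_ge0 //; have := B_ge1 xi; rewrite -/B => B1.
  have : 1 <= B ^+ 2 by rewrite exprn_ege1.
  by lra.
split.
- exact: ch_b_ge0 ch.
- exact: ch_b_lim ch.
- by move=> n; case: (ch_order ch n).
- by move=> n; exact: (ch_s_le hxi ch D01 lt1 t_range).
- by move=> n; exact: (ch_r_le hxi ch D01 lt1 t_range).
- by move=> n; have := ch_area_ln hxi ch n; rewrite /K /a /b /r /s; lra.
- by move=> n; have := cs_cubic n; rewrite /K; lra.
- move=> n Jn; have [d1 _] := cs_det4_next n.
  by have := cs_jump (ltnSn n) d1 Jn; rewrite /K; lra.
- by move=> n J1 J2; have := cs_jump2 J1 J2; rewrite /K; lra.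
- exact: cs_inf.
- exact: cs_indep.
Qed.
End ChainSystem.

(** * The lower bound for the constant *)

Lemma chain_shift (R : realType) (xi D l : R) (p y z : nat -> 'rV[R]_4) (N : nat) :
  chain xi D l p y z ->
  chain xi D l (fun n => p (n + N)%N) (fun n => y (n + N)%N) (fun n => z (n + N)%N).
Proof.
case=> *; split => // n; rewrite ?addSn //.
by apply: (@le_trans _ _ (n + N)%:R) => //; rewrite ler_nat leq_addr.
Qed.

(** The constants in the exponent system depend on [xi] only, so
    [exponent_system_bound] bounds log (2 D) from below, where D is (1 + |xi|) c. *)
Lemma no_uniform_approximation (R : realType) (xi : R) :
  extension_degree_gt xi 3 -> exists2 c0 : R, 0 < c0 &
  forall c : R, 0 < c -> c < c0 -> ~ uniformly_approximable xi c (lambda3 R).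
Proof.
move=> hxi; set t := ratio3 R; have ht := ratio3_bounds R; rewrite -/t in ht.
have /andP[t1 t2] := ht.
have lt1 : (1 + t) * lambda3 R = 1 := lambda3_ratio3 R.
have /andP[l1 l2] := lambda3_bounds R.
set B := 1 + `|xi|; have B0 : 0 < B := B_gt0 xi; have B1 : 1 <= B := B_ge1 xi.
set K := ln 4 + ln (8 * B ^+ 2) + ln 36.
have K0 : 0 <= K.
  have : 1 <= B ^+ 2 by rewrite exprn_ege1.
  by move=> h; rewrite /K !addr_ge0 ?ln_ge0 ?ler1n //; lra.
set C := (t ^+ 2 - 1) * (1 + t) ^+ 2 + (1 + t + t ^+ 2) * (1 + t).
have C0 : 0 <= C.
  have tt : 0 <= t ^+ 2 - 1 by nra.
  by rewrite /C addr_ge0 // mulr_ge0 ?exprn_ge0 //; lra.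
have P0 : 0 < 3 * t * (1 + t) by apply: mulr_gt0; lra.
set q := C * K / (3 * t * (1 + t)).
have q0 : 0 <= q by apply: divr_ge0; [exact: mulr_ge0|exact: ltW].
exists (expR (- q) / (2 * B)); first by apply: divr_gt0; [exact: expR_gt0|exact: mulr_gt0].
move=> c c0 hc hU; set D := B * c.
have D0 : 0 < D by exact: mulr_gt0.
have Dq : 2 * D < expR (- q).
  by move: hc; rewrite ltr_pdivlMr ?mulr_gt0 // /D; lra.
have D1 : 2 * D <= 1.
  apply: le_trans (ltW Dq) _; rewrite -[leRHS]expR0 ler_expR; lra.
have D01 : 0 < 2 * D <= 1 by rewrite D1 mulr_gt0.
have [X0 X1 hX] := uniform_pointsP c0 hU.
have l01 : 0 < lambda3 R <= 1 by apply/andP; split; lra.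
have [x ms] := minimal_sequence_exists hxi D0 l01 X1 hX.
have [p [y [z ch]]] := chain_exists hxi ms.
(* Small indices are discarded; the threshold may depend on c, the constants do not. *)
have [N hN] := ch_nonspecial hxi ch D01 lt1 ht.
have E := chain_exponent_system hxi (chain_shift N ch) D01 lt1 ht
  (fun n => (hN _ (leq_addl n N)).1) (fun n => (hN _ (leq_addl n N)).2).
have g0 : ln (2 * D) <= 0 by rewrite ln_le0.
have := exponent_system_bound ht (ratio3_quartic R) K0 g0 E.
rewrite -/C => h.
have h1 : ln (2 * D) < - q.
  by rewrite -[- q]expRK ltr_ln ?posrE ?expR_gt0 // mulr_gt0.
have h2 : 0 < 3 * t * (1 + t) * (- q - ln (2 * D)) by apply: mulr_gt0 => //; lra.
have h3 : 3 * t * (1 + t) * q = C * K by rewrite /q mulrC divfK // gt_eqF.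
by lra.
Qed.

Lemma uniformly_approximable_weaken (R : realType) (xi c c' lambda mu : R) :
  0 < c -> 0 < c' -> mu < lambda ->
  uniformly_approximable xi c lambda -> uniformly_approximable xi c' mu.
Proof.
move=> c0 c'0 ml [M [Mr hM]].
set d := lambda - mu; have d0 : 0 < d by rewrite /d subr_gt0.
set X0 := Num.max 1 ((c / c') `^ d^-1).
exists (Num.max M X0); split; first exact: num_real.
move=> X; rewrite gt_max => /andP[XM XX0].
have [x x0 [h0 h1 h2 h3]] := hM X XM.
have X1 : 1 < X by apply: le_lt_trans XX0; rewrite le_max lexx.
have Xd : c / c' <= X `^ d.
  rewrite (_ : c / c' = ((c / c') `^ d^-1) `^ d); last first.
    by rewrite -powRrM mulVf ?gt_eqF // powRr1 // divr_ge0 // ltW.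
  apply: ge0_ler_powR; rewrite ?nnegrE ?powR_ge0 //; [exact: ltW|lra|].
  by apply: ltW; apply: le_lt_trans XX0; rewrite le_max lexx orbT.
have le_e : c * X `^ (- lambda) <= c' * X `^ (- mu).
  have -> : X `^ (- mu) = X `^ (- lambda) * X `^ d.
    rewrite -powRD; first by congr (_ `^ _); rewrite /d; ring.
    by apply/implyP => _; rewrite gt_eqF //; lra.
  rewrite mulrCA [c * _]mulrC; apply: ler_wpM2l; first exact: powR_ge0.
  by move: Xd; rewrite ler_pdivrMr // mulrC.
by exists x => //; split => //; exact: le_trans le_e.
Qed.

Theorem mainTheorem1 (R : realType) (xi : R) (hxi : extension_degree_gt xi 3) :
  exists c0 : R, 0 < c0 /\
    forall c lambda : R, 0 < c -> 0 < lambda ->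
      uniformly_approximable xi c lambda ->
      lambda <= lambda3 R /\ (lambda = lambda3 R -> c0 <= c).
Proof.
have [c0 c00 hc0] := no_uniform_approximation hxi.
exists c0; split => // c lambda c_gt0 _ hU; split.
- rewrite leNgt; apply/negP => hl.
  have c2 : 0 < c0 / 2 by rewrite divr_gt0.
  apply: (hc0 (c0 / 2)) => //; first by lra.
  exact: uniformly_approximable_weaken hU.
- move=> lE; rewrite leNgt; apply/negP => hc.
  by apply: (hc0 c) => //; rewrite -lE.
Qed.
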